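(* Fix a prime power $q$. Let $\psi_i$, for $i=1,2,\dots,n$, be arithmetic functions on $\mathbb{F}_q[t]$ such that each of them satisfies the growth condition, the Siegel-Walfisz bound and the Bombieri-Vinogradov type equidistribution property. Then the Dirichlet convolution $\psi_1\ast\psi_2\ast\cdots\ast\psi_n$ also satisfies the growth condition, the Siegel-Walfisz bound and the Bombieri-Vinogradov type equidistribution property.
   Context: $\mathbb{F}_q$ is the finite field with $q$ elements, and $q$ is fixed. In all sums below $f,g,h$ run over monic polynomials in $\mathbb{F}_q[t]$. An arithmetic function is a map $\psi:\mathbb{F}_q[t]\to\mathbb{C}$ (only its values on monic polynomials matter). $\tau(f)$ is the number of monic divisors of $f$, and $\phi(m)=\#(\mathbb{F}_q[t]/(m))^{*}$. The Dirichlet convolution is $\psi_1\ast\psi_2(f)=\sum_{gh=f}\psi_1(g)\psi_2(h)$, over monic $g,h$ with $gh=f$. A (multiplicative) character $\chi$ modulo a non-constant polynomial $m$ is a character of $(\mathbb{F}_q[t]/(m))^{*}$, extended to $\mathbb{F}_q[t]$ by $\chi(f)=\chi(f \bmod m)$ if $(f,m)=1$ and $\chi(f)=0$ otherwise. It is principal if $\chi(f)=1$ for all $f$ with $(f,m)=1$. Its conductor is the monic $d\mid m$ of least degree such that $\chi$ is induced by a (primitive) character modulo $d$. Here $\log$ is the logarithm to base $q$. For an arithmetic function $\psi$ define: Growth condition: $\psi(f)=O(\tau(f)^{C})$ for some $C>0$. Siegel-Walfisz bound: for all sufficiently large $D>0$, for a non-principal character $\chi$ with conductor of degree $\le D\log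 N$, $$\sum_{\deg(f)=N}\psi(f)\chi(f)=O\left(\frac{q^N}{N^{3D}}\right),$$ with implied constant independent of $N$ and $\chi$. Bombieri-Vinogradov type equidistribution property: for $m,l\in\mathbb{F}_q[t]$ with $m$ monic and $(m,l)=1$, let $$E(M;m,l;\psi)=\sum_{\substack{f\equiv l\ (\mathrm{mod}\ m)\\ \deg(f)=M}}\psi(f)-\frac{1}{\phi(m)}\sum_{\substack{(f,m)=1\\ \deg(f)=M}}\psi(f).$$ Then for any $A>0$ there exists $B=B(A)>0$ such that $$\sum_{\deg(m)\le \frac N2-B\log N}\ \max_{M\le N}\ \max_{(m,l)=1}|E(M;m,l;\psi)|\ll_A\frac{q^N}{N^A},$$ the outer sum being over monic $m$. *)

(* Defs.v *)
From mathcomp Require Import all_boot all_order all_algebra.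
From mathcomp Require Import reals exp.
From mathcomp Require Import complex.

Set Implicit Arguments.
Unset Strict Implicit.
Unset Printing Implicit Defensive.

Import Order.TTheory GRing.Theory Num.Theory.
Local Open Scope ring_scope.
Local Open Scope complex_scope.

Section FunctionField.

Variables (R : realType) (F : finFieldType).

Definition arithfun := {poly F} -> R[i].

(* q, as a real number. *)
Definition qR : R := #|F|%:R.

Definition logq (x : R) : R := ln x / ln qR.

(* {poly_n F} is the finite type of polynomials of size <= n, i.e. of
   degree < n, so that every sum below is a finite sum. *)
Definition monic_deg (N : nat) (f : {poly F}) : bool :=
  (f \is monic) && (size f == N.+1).

Definition tau (f : {poly F}) : nat :=
  #|[pred g : {poly_(size f) F} | ((g : {poly F}) \is monic) && (g %| f)]|.

(* The convolution only depends on, and is only meaningful for, values at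
   monic polynomials: it vanishes at non-monic f. *)
Definition dconv (psi1 psi2 : arithfun) : arithfun := fun f =>
  \sum_(g : {poly_(size f) F} | (g : {poly F}) \is monic)
    \sum_(h : {poly_(size f) F} |
        ((h : {poly F}) \is monic) && ((g : {poly F}) * h == f))
      psi1 g * psi2 h.

(* psi_0 * psi_1 * ... * psi_n, bracketed to the left. *)
Definition dconvs (n : nat) (psi : 'I_n.+1 -> arithfun) : arithfun :=
  foldl dconv (psi ord0) [seq psi (lift ord0 i) | i <- enum 'I_n].

(* The ring F[t]/(m), m != 0, is represented by the remainders modulo m.
   ({poly %/ m} is not used: it denotes F[t]/(t) unless m is monic and
   non-constant, whereas phi(1) = 1 is needed below.) *)
Definition residue (m : {poly F}) := {poly_(size m).-1 F}.

Definition unit_residue (m : {poly F}) (r : residue m) : bool :=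
  [exists s : residue m, ((r : {poly F}) * s) %% m == 1 %% m].

Definition phi (m : {poly F}) : nat := #|@unit_residue m|.

Lemma unit_residueE (m : {poly F}) (r : residue m) :
  m != 0 -> unit_residue r = coprimep r m.
Proof.
move=> m0; apply/existsP/Bezout_coprimepP => [[s /eqP rs]|[[u v] /= /eqpP]].
  exists ((s : {poly F}), - (((r : {poly F}) * s - 1) %/ m)) => /=.
  have dv : m %| (r : {poly F}) * s - 1.
    by apply/modp_eq0P; rewrite modpD modpN rs subrr.
  by rewrite mulNr divpK // opprB [(s : {poly F}) * _]mulrC addrC subrK eqpxx.
move=> [[a b] /= /andP[a0 b0] e].
have sz : (size (((b^-1 * a) *: u) %% m)%R <= (size m).-1)%N.
  by rewrite -ltnS prednK ?size_poly_gt0 // ltn_modp.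
exists (NPoly sz); apply/eqP => /=.
rewrite modp_mul -scalerAr [(r : {poly F}) * u]mulrC.
have -> : (b^-1 * a) *: (u * r) = 1 - ((b^-1 * a) *: v) * m.
  apply/eqP; rewrite eq_sym subr_eq -scalerAl -scalerDr -scalerA e.
  by rewrite scalerA mulVf ?scale1r.
by rewrite modpD modpN modp_mull oppr0 addr0.
Qed.

(* A character of the group (F[t]/(m))^*: the law of the group is the product
   followed by reduction modulo m.  Values off the units are irrelevant. *)
Definition residue_character (m : {poly F}) (chi0 : {poly F} -> R[i]) : Prop :=
  chi0 (1 %% m) = 1 /\
  forall r s : residue m, unit_residue r -> unit_residue s ->
    chi0 (((r : {poly F}) * s) %% m) = chi0 r * chi0 s.

Definition character_mod (m : {poly F}) (chi : arithfun) : Prop :=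
  exists2 chi0 : {poly F} -> R[i], residue_character m chi0 &
    forall f, chi f = if coprimep f m then chi0 (f %% m) else 0.

Definition principal_mod (m : {poly F}) (chi : arithfun) : Prop :=
  forall f, coprimep f m -> chi f = 1.

Definition induced_from (m : {poly F}) (chi : arithfun) (d : {poly F}) : Prop :=
  exists2 chi' : arithfun, character_mod d chi' &
    forall f, coprimep f m -> chi f = chi' f.

Definition is_conductor (m : {poly F}) (chi : arithfun) (d : {poly F}) : Prop :=
  [/\ d \is monic, d %| m, induced_from m chi d &
      forall d' : {poly F}, d' \is monic -> d' %| m -> induced_from m chi d' ->
        (size d <= size d')%N].

Definition growth_condition (psi : arithfun) : Prop :=
  exists2 C : R, 0 < C & exists K : R, forall f : {poly F}, f \is monic ->
    Normc.normc (psi f) <= K * (tau f)%:R `^ C.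

(* deg d is (size d).-1.  The modulus m of chi is arbitrary: only the degree of
   the conductor is bounded, and K depends neither on N nor on chi. *)
Definition siegel_walfisz (psi : arithfun) : Prop :=
  exists2 D0 : R, 0 < D0 & forall D : R, D0 <= D ->
  exists K : R, forall (N : nat) (m d : {poly F}) (chi : arithfun),
    (0 < N)%N -> (1 < size m)%N -> character_mod m chi ->
    ~ principal_mod m chi -> is_conductor m chi d ->
    (size d).-1%:R <= D * logq N%:R ->
    Normc.normc (\sum_(f : {poly_N.+1 F} | monic_deg N f) psi f * chi f)
      <= K * (qR ^+ N / N%:R `^ (3 * D)).

Definition bvE (M : nat) (m l : {poly F}) (psi : arithfun) : R[i] :=
  \sum_(f : {poly_M.+1 F} | monic_deg M f && (f %% m == l %% m)) psi f
  - (phi m)%:R^-1 *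
    \sum_(f : {poly_M.+1 F} | monic_deg M f && coprimep f m) psi f.

Lemma bvE_mod (M : nat) (m l : {poly F}) (psi : arithfun) :
  bvE M m (l %% m) psi = bvE M m l psi.
Proof. by rewrite /bvE modp_id. Qed.

(* By bvE_mod it suffices to let l range over the remainders modulo m. *)
Definition bvE_max (N : nat) (m : {poly F}) (psi : arithfun) : R :=
  \big[Num.max/0]_(M < N.+1)
    \big[Num.max/0]_(l : residue m | coprimep m l) Normc.normc (bvE M m l psi).

(* Since B > 0 and N >= 1, the bound on deg m forces deg m <= N. *)
Definition bombieri_vinogradov (psi : arithfun) : Prop :=
  forall A : R, 0 < A -> exists2 B : R, 0 < B & exists K : R,
  forall N : nat, (0 < N)%N ->
    \sum_(m : {poly_N.+1 F} | ((m : {poly F}) \is monic) &&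
        ((size (m : {poly F})).-1%:R <= N%:R / 2 - B * logq N%:R))
      bvE_max N m psi
    <= K * (qR ^+ N / N%:R `^ A).

End FunctionField.

(* Main.v *)
From HB Require Import structures.
Require Import Defs.
From mathcomp Require Import all_boot all_order all_algebra.
From mathcomp Require Import all_fingroup all_solvable all_field all_character.
From mathcomp Require Import reals exp.
From mathcomp Require Import complex.
From mathcomp Require Import boolp ring lra zify.

(* The Bombieri-Vinogradov sum for [psi1 * psi2] is split into bilinear sums over [deg g = a], [deg h = b].  When [q^a] or [q^b] is at most a power of [N], the short variable is fixed and the hypothesis on the other function applies.  Otherwise the discrepancy is expanded into characters modulo [m], and each nonprincipal character is replaced by the primitive character modulo [d] inducing it.  Conductors of small degree are handled by the Siegel-Walfisz bound, the others by Cauchy-Schwarz and the large sieve.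

   The large sieve is elementary over F_q[t]: a product [chi1 * conj chi2] of inequivalent characters has modulus [d1 * d2] and sums to exactly 0 over all polynomials of degree < L as soon as [deg d1 + deg d2 <= L].  Primitive characters of conductor degree [k] are therefore pairwise orthogonal on that set when [2 k <= L], and the large sieve is Bessel's inequality. *)

Set Implicit Arguments.
Unset Strict Implicit.
Unset Printing Implicit Defensive.
Import Order.TTheory GRing.Theory Num.Theory.

(** * Characters of finite abelian groups *)

Section AbelianCharacters.
Local Open Scope ring_scope.

(** Since deg g + deg h = M exactly, the two variables separate with no further device. The obstacle
    is the conductor: orthogonality concerns primitive characters of one degree k, while a modulus m
    also carries imprimitive ones. Writing m = d e with d the conductor, the condition (f, e) = 1
    goes into the coefficients, phi(d e) >= phi(d) phi(e) splits the weight, and the sum of 1 /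
    phi(e) costs only a power of N. For fixed k the sieve on degrees < L, where L >= 2 k, has
    constant q^(L - k). Each of N^D <= q^k, N^(2D) <= q^a, N^(2D) <= q^b and q^(2k) N^(2B) <= q^N
    provides the saving in one range of k. For conductors of small degree the Siegel-Walfisz bound
    saves a power of the degree a of the factor, which is a power of N once a >= sqrt N. If both
    degrees are below sqrt N the trivial bound is enough: about q^(N/2) moduli times q^(2 sqrt N)
    stays far below q^N. *)

Lemma primitive_root_exists (C : numClosedFieldType) (n : nat) :
  (0 < n)%N -> exists z : C, n.-primitive_root z.
Proof.
pose p : {poly C} := 'X^n - 1; have [r Dp] := closed_field_poly_normal p.
move=> n_gt0; rewrite (monicP _) ?monicXnsubC // scale1r in Dp.
have rn1: all n.-unity_root r by apply/allP=> z; rewrite -root_prod_XsubC -Dp.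
have sz_r: (n < (size r).+1)%N.
  by rewrite -(size_prod_XsubC r id) -Dp size_XnsubC.
have [|z] := hasP (has_prim_root n_gt0 rn1 _ sz_r); last by exists z.
by rewrite -separable_prod_XsubC -Dp separable_Xn_sub_1 // pnatr_eq0 -lt0n.
Qed.

(* The characters of [G] over [algC] are carried over to [C] by [z ^+ k |-> zeta ^+ k], for primitive roots of unity [z] of [algC] and [zeta] of [C]. *)
Lemma abelian_dual (C : numClosedFieldType) (gT : finGroupType) (G : {group gT}) :
  abelian G ->
  exists X : 'I_#|G| -> gT -> C,
  [/\ forall i, {in G &, {morph X i : x y / (x * y)%g >-> x * y}},
      forall i, {in G, forall x, `|X i x| = 1},
      {in G &, forall x y, \sum_i X i x * (X i y)^* = if x == y then #|G|%:R else 0} &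
      forall i j, {in G, X i =1 X j} -> i = j].
Proof.
move=> abG; set n := #|G|.
have n0 : (0 < n)%N := cardG_gt0 G.
have [z zP] := C_prim_root_exists n0.
have [w wP] := primitive_root_exists C n0.
(* [k] is the discrete logarithm to base [z]; the default of [odflt] is never reached on n-th roots
   of unity. *)
pose k (v : algC) : nat := odflt (Ordinal n0) [pick i : 'I_n | v == z ^+ i].
have kP v : v ^+ n = 1 -> z ^+ k v = v.
  move=> vn; rewrite /k; case: pickP => [i /eqP //|none].
  have [i vi] := prim_rootP zP vn.
  by have := none i; rewrite vi eqxx.
have wn j : w ^+ j ^+ n = 1 by rewrite exprAC (prim_expr_order wP) expr1n.
have wE j l : (w ^+ j == w ^+ l) = (z ^+ j == z ^+ l).
  by rewrite (eq_prim_root_expr wP) (eq_prim_root_expr zP).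
have nI : Nirr G = n by rewrite NirrE; apply/eqP; move: abG; rewrite card_classes_abelian.
have lin (i : Iirr G) : 'chi_i \is a linear_char by apply/char_abelianP.
have unit (i : Iirr G) x : x \in G -> 'chi_i x ^+ n = 1.
  move=> xG; have /dvdnP[d nd] := order_dvdG xG.
  by rewrite /n nd mulnC exprM lin_char_unity_root ?expr1n.
pose Y (i : Iirr G) x := w ^+ k ('chi_i x).
have YM i : {in G &, {morph Y i : x y / (x * y)%g >-> x * y}}.
  move=> x y xG yG; rewrite /Y -exprD; apply/eqP.
  rewrite wE exprD !kP ?unit ?groupM //.
  by rewrite (lin_charM (lin i)) //.
have Y1 i : {in G, forall x, `|Y i x| = 1}.
  move=> x xG; apply/eqP; rewrite -(@pexpr_eq1 _ _ n n0) ?normr_ge0 //.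
  by rewrite -normrX wn normr1.
have YE i j x : x \in G -> Y i x = Y j x -> 'chi_i x = 'chi_j x.
  by move=> xG /eqP; rewrite wE !kP ?unit // => /eqP.
have YI i j : {in G, Y i =1 Y j} -> i = j.
  move=> e; apply: irr_inj; apply/cfun_inP => x xG; exact/YE/e.
have Y0 i x : x \in G -> Y i x != 0.
  by move=> xG; rewrite -normr_eq0 Y1 // oner_neq0.
(* The transport to [C] is multiplicative but not additive, so orthogonality is proved anew:
   multiplication by a character [i0] that is nontrivial at [x] permutes the characters and
   multiplies the sum by a number other than 1. *)
have Ysum x : x \in G -> x != 1%g -> \sum_i Y i x = 0.
  move=> xG x1.
  have [i0 ni0] : exists i0 : Iirr G, 'chi_i0 x != 1.
    apply/existsP; rewrite -negb_forall; apply: contra x1 => /forallP tr.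
    rewrite -in_set1 -[[set 1%g]](TI_cfker_irr G); apply/bigcapP => i _.
    by rewrite cfkerEirr inE (eqP (tr i)) lin_char1 ?lin.

  pose h i := cfIirr ('chi_i0 * 'chi_i).
  have hE i : 'chi_(h i) = 'chi_i0 * 'chi_i by rewrite cfIirrE // mul_lin_irr // mem_irr.
  have hY i y : y \in G -> Y (h i) y = Y i0 y * Y i y.
    move=> yG; rewrite /Y -exprD; apply/eqP; rewrite wE exprD !kP ?unit //.
    by rewrite hE cfunE.
  have hI : injective h.
    move=> i j e; apply: YI => y yG.
    by apply: (mulfI (Y0 i0 y yG)); rewrite -!hY // e.
  have : \sum_i Y i x = Y i0 x * \sum_i Y i x.
    rewrite mulr_sumr {1}(reindex_inj hI) /=.
    by apply: eq_bigr => i _; rewrite hY.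
  move/eqP; rewrite -[X in X == _]mul1r -subr_eq0 -mulrBl mulf_eq0 subr_eq0.
  case/orP => [|/eqP //]; rewrite eq_sym -(expr0 w) wE kP ?unit // expr0.
  by rewrite (negPf ni0).
pose c := cast_ord (esym nI).
exists (fun i => Y (c i)); split => //.
- move=> x y xG yG.
  have cb : bijective c by exists (cast_ord nI) => i; rewrite /c ?cast_ordK ?cast_ordKV.
  have -> : \sum_i Y (c i) x * (Y (c i) y)^* = \sum_(i : Iirr G) Y i x * (Y i y)^*.
    by rewrite [RHS](reindex c) //; apply: onW_bij.
  have Yi1 i : Y i 1%g = 1.
    by apply: (mulfI (Y0 i 1%g (group1 G))); rewrite -YM ?group1 // mulg1 mulr1.
  have e i : Y i x * (Y i y)^* = Y i (x * y^-1)%g.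
    rewrite YM ?groupV //; congr (_ * _); apply: (mulfI (Y0 i y yG)).
    by rewrite -YM ?groupV // mulgV Yi1 -normCK Y1 // expr1n.
  under eq_bigr do rewrite e.
  have [->|xy] := eqVneq x y.
    rewrite (eq_bigr (fun=> 1)) => [|i _]; last by rewrite mulgV.
    by rewrite sumr_const card_ord nI.
  by apply: Ysum; rewrite ?groupM ?groupV // -eq_mulgV1.
- by move=> i j e; apply/(@cast_ord_inj _ _ (esym nI))/YI.
Qed.

End AbelianCharacters.

(** * The unit group modulo a polynomial *)

Section Residues.
Local Open Scope ring_scope.
Variable F : finFieldType.
Implicit Types f g m d e : {poly F}.

Definition to_residue m f : residue m := npolyp (size m).-1 (f %% m).

Lemma to_residueE m f : m != 0 -> to_residue m f = f %% m :> {poly F}.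
Proof.
move=> m0; apply: npolypK.
by rewrite -ltnS prednK ?size_poly_gt0 // ltn_modp.
Qed.

Lemma residue_modp m (r : residue m) : m != 0 -> (r : {poly F}) %% m = r.
Proof.
move=> m0; rewrite modp_small //.
by rewrite -[X in (_ < X)%N]prednK ?size_poly_gt0 // ltnS size_npoly.
Qed.

Lemma residue_inj m : injective (fun r : residue m => r : {poly F}).
Proof. exact: val_inj. Qed.

Lemma modpM m f g : ((f %% m) * (g %% m)) %% m = (f * g) %% m.
Proof. by rewrite modp_mul mulrC modp_mul mulrC. Qed.

(** The proof of [m != 0] is a parameter of the type, so that the group structure, which depends on
    it, can be a canonical instance. *)
Definition unit_group m of m != 0 := {r : residue m | unit_residue r}.

Section UnitGroup.
Variables (m : {poly F}) (m0 : m != 0).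
Local Notation U := (unit_group m0).

HB.instance Definition _ := Finite.on U.

Lemma unit_to_residue f : coprimep f m -> unit_residue (to_residue m f).
Proof. by move=> fm; rewrite unit_residueE // to_residueE // coprimep_modl. Qed.

Lemma coprimep_unit (u : U) : coprimep (val u : {poly F}) m.
Proof. by rewrite -unit_residueE ?(valP u). Qed.

Definition unit_one : U := Sub _ (unit_to_residue (coprime1p m)).

(** Polynomials not coprime to [m] get the default class 1; the uses are guarded by [coprimep]. *)
Definition unit_class f : U := insubd unit_one (to_residue m f).

Lemma unit_classE f : coprimep f m -> val (unit_class f) = f %% m :> {poly F}.
Proof. by move=> fm; rewrite val_insubd unit_to_residue // to_residueE. Qed.

Lemma unit_class_eq f g : coprimep f m -> coprimep g m ->
  (unit_class f == unit_class g) = (f %% m == g %% m).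
Proof.
move=> fm gm; apply/eqP/eqP => [e|e]; first by rewrite -!unit_classE // e.
by apply/val_inj/residue_inj; rewrite !unit_classE.
Qed.

Definition unit_mul (u v : U) : U := unit_class ((val u : {poly F}) * (val v : {poly F})).

Lemma unit_mulE u v :
  val (unit_mul u v) = ((val u : {poly F}) * (val v : {poly F})) %% m :> {poly F}.
Proof. by rewrite unit_classE // coprimepMl !coprimep_unit. Qed.

Definition unit_inv (u : U) : U := odflt unit_one [pick v | unit_mul v u == unit_one].

Fact unit_mulA : associative unit_mul.
Proof.
move=> u v w; apply/val_inj/residue_inj; rewrite !unit_mulE.
by rewrite modp_mul mulrA [in RHS]mulrC modp_mul mulrC.
Qed.
Fact unit_mul1 : left_id (unit_one) (unit_mul).
Proof.
move=> u; apply/val_inj/residue_inj; rewrite unit_mulE /= to_residueE //.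
by rewrite mulrC modp_mul mulr1 residue_modp.
Qed.

Fact unit_mulV : left_inverse unit_one unit_inv unit_mul.
Proof.
move=> u; rewrite /unit_inv; case: pickP => [v /eqP //|none] /=.
have /existsP[s /eqP us] := valP u.
have sm : coprimep s m.
  suff : coprimep ((val u : {poly F}) * s) m by rewrite coprimepMl => /andP[].
  by rewrite -coprimep_modl us coprimep_modl coprime1p.
have := none (unit_class s); rewrite -val_eqE /= -val_eqE /= unit_mulE unit_classE //.
by rewrite mulrC modp_mul us to_residueE // eqxx.
Qed.

HB.instance Definition _ := Finite_isGroup.Build U unit_mulA unit_mul1 unit_mulV.

Lemma unit_mulgC : commutative (fun u v : U => (u * v)%g).
Proof. by move=> u v; apply/val_inj/residue_inj; rewrite !unit_mulE mulrC. Qed.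

Lemma unit_class1 : unit_class 1 = 1%g.
Proof.
change (unit_class 1 = unit_one); apply/val_inj/residue_inj.
by rewrite unit_classE ?coprime1p //= to_residueE.
Qed.

Lemma unit_classM f g : coprimep f m -> coprimep g m ->
  unit_class (f * g) = (unit_class f * unit_class g)%g.
Proof.
move=> fm gm; change (unit_class (f * g) = unit_mul (unit_class f) (unit_class g)).
apply/val_inj/residue_inj.
by rewrite unit_mulE !unit_classE ?coprimepMl ?fm ?gm // modpM.
Qed.

Lemma card_unit_group : #|[set: U]| = phi m.
Proof. by rewrite cardsT card_sig. Qed.

End UnitGroup.
End Residues.

(** * Dirichlet characters *)

Section DirichletCharacters.
Local Open Scope ring_scope.
Variables (C : numClosedFieldType) (F : finFieldType).
Implicit Types (f g m d e : {poly F}) (chi : {poly F} -> C).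

(** Working form of [character_mod], equivalent to it for [m != 0] by [character_modP]: no auxiliary
    function on residues has to be carried along. *)
Definition dirichlet m chi : Prop :=
  [/\ chi 1 = 1, {morph chi : f g / f * g}, forall f, chi (f %% m) = chi f &
      forall f, ~~ coprimep f m -> chi f = 0].

Lemma dirichlet_modE m chi f g : dirichlet m chi -> f %% m = g %% m -> chi f = chi g.
Proof. by move=> [_ _ cm _] fg; rewrite -(cm f) fg cm. Qed.

Lemma coprimep_inverse m f : m != 0 -> coprimep f m ->
  exists2 g, coprimep g m & (f * g) %% m = 1 %% m.
Proof.
move=> m0 fm; have /existsP[s /eqP us] := unit_to_residue m0 fm.
exists s; last by rewrite -us to_residueE // mulrC -modp_mul [in RHS]mulrC.
have : coprimep ((f %% m) * s) m by rewrite -coprimep_modl -(to_residueE f m0) us coprimep_modl coprime1p.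
by rewrite coprimepMl => /andP[].
Qed.

Lemma dirichlet_neq0 m chi f : m != 0 -> dirichlet m chi -> coprimep f m -> chi f != 0.
Proof.
move=> m0 cX fm; have [g gm fg] := coprimep_inverse m0 fm.
apply/eqP => f0; have : chi (f * g) = chi 1 by apply: dirichlet_modE cX fg.
by case: cX => c1 cM _ _; rewrite cM f0 mul0r c1 => /esym/eqP; rewrite oner_eq0.
Qed.

Lemma dirichlet_family m : m != 0 -> exists X : 'I_(phi m) -> {poly F} -> C,
  [/\ forall i, dirichlet m (X i),
      forall i f, coprimep f m -> `|X i f| = 1,
      forall f g, coprimep f m -> coprimep g m ->
        \sum_i X i f * (X i g)^* = if f %% m == g %% m then (phi m)%:R else 0 &
      forall i j, X i =1 X j -> i = j].
Proof.
move=> m0; pose G := [set: unit_group m0]%G.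
have abG : abelian G by apply/centsP => u _ v _; apply: unit_mulgC.
have [X [XM X1 Xo XI]] := abelian_dual C abG.
have cG : #|G| = phi m := card_unit_group m0.
pose c := cast_ord (esym cG).
have cb : bijective c by exists (cast_ord cG) => i; rewrite /c ?cast_ordK ?cast_ordKV.
have inG u : u \in G by rewrite inE.
have X11 i : X i 1%g = 1.
  have x0 : X i 1%g != 0 by rewrite -normr_eq0 X1 // oner_neq0.
  by apply: (mulfI x0); rewrite -XM // mulg1 mulr1.
exists (fun i f => if coprimep f m then X (c i) (unit_class m0 f) else 0).
split=> [i|i f fm|f g fm gm|i j e].
- split=> [|f g|f|f /negPf -> //].
  + by rewrite coprime1p -[RHS](X11 (c i)) unit_class1.
  + rewrite coprimepMl; case: ifP => [/andP[fm gm]|]; last first.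
      by move/negbT; rewrite negb_and => /orP[] /negPf ->; rewrite ?mul0r ?mulr0.
    by rewrite fm gm unit_classM // XM.
  + rewrite coprimep_modl; case: ifP => // fm; congr (X _ _).
    by apply/val_inj/residue_inj; rewrite !unit_classE ?coprimep_modl // modp_id.
- by rewrite fm X1.
- rewrite fm gm.
  have -> : \sum_i X (c i) (unit_class m0 f) * (X (c i) (unit_class m0 g))^* =
            \sum_i X i (unit_class m0 f) * (X i (unit_class m0 g))^*.
    by rewrite [RHS](reindex c) //; apply: onW_bij.
  by rewrite Xo // unit_class_eq // cG.
- apply/(bij_inj cb)/XI => u _.
  have := e (val u : {poly F}); rewrite coprimep_unit.
  suff -> : unit_class m0 (\val u : {poly F}) = u by [].
  by apply/val_inj/residue_inj; rewrite unit_classE ?coprimep_unit // residue_modp.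
Qed.

Lemma sum_residue_mul m f (H : {poly F} -> C) : m != 0 -> coprimep f m ->
  \sum_(r : residue m) H r = \sum_(r : residue m) H ((f * r) %% m).
Proof.
move=> m0 fm; have [g gm fg] := coprimep_inverse m0 fm.
rewrite (reindex_inj (h := fun r : residue m => to_residue m (f * r))) /=.
  by apply: eq_bigr => r _; rewrite to_residueE.
move=> r s /(congr1 (fun r : residue m => (g * r) %% m)).
rewrite !to_residueE // !modp_mul !mulrA [g * f]mulrC.
rewrite ![f * g * _]mulrC -(modp_mul (r : {poly F})) -(modp_mul (s : {poly F})) fg.
by rewrite !modp_mul !mulr1 !residue_modp // => /residue_inj.
Qed.

(** If [chi] had inner product 0 with every [X i], the orthogonality relation would give
    [phi m * chi 1 = 0]. A nonzero inner product [c i] is multiplied by [chi f * (X i f)^*] when the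
    residues are multiplied by [f], so that factor is 1. *)
Lemma dirichlet_complete m (X : 'I_(phi m) -> {poly F} -> C) chi : m != 0 ->
  (forall i, dirichlet m (X i)) ->
  (forall i f, coprimep f m -> `|X i f| = 1) ->
  (forall f g, coprimep f m -> coprimep g m ->
    \sum_i X i f * (X i g)^* = if f %% m == g %% m then (phi m)%:R else 0) ->
  dirichlet m chi -> exists i, X i =1 chi.
Proof.
move=> m0 XD X1 Xo cX.
pose c i := \sum_(r : residue m) chi r * (X i r)^*.
have phi0 : (phi m)%:R != 0 :> C.
  have := Xo 1 1 (coprime1p m) (coprime1p m); rewrite eqxx => <-.
  under eq_bigr => i _ do rewrite -normCK X1 ?coprime1p // expr1n.
  rewrite sumr_const card_ord pnatr_eq0 -lt0n.
  by apply/card_gt0P; exists (to_residue m 1); apply: (unit_to_residue m0 (coprime1p m)).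
have [i ci] : exists i, c i != 0.
  apply/existsP; rewrite -negb_forall; apply/negP => /forallP c0.
  have : \sum_(r : residue m) chi r * \sum_i X i 1 * (X i r)^* = 0.
    under eq_bigr do rewrite mulr_sumr.
    rewrite exchange_big big1 //= => i _; under eq_bigr do rewrite mulrCA.
    by rewrite -mulr_sumr -/(c i) (eqP (c0 i)) mulr0.
  rewrite (bigD1 (to_residue m 1)) //= [X in _ + X]big1 ?addr0 => [|r rn].
    rewrite to_residueE // Xo ?coprime1p ?coprimep_modl ?coprime1p // modp_id eqxx.
    by case: (cX) => c1 _ -> _; rewrite c1 mul1r; apply/eqP.
  have [rm|rm] := boolP (coprimep (r : {poly F}) m); last first.
    by case: (cX) => _ _ _ ->; rewrite // mul0r.
  rewrite Xo ?coprime1p // ifN ?mulr0 //; apply: contra rn => /eqP e.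
  by apply/eqP/residue_inj; rewrite to_residueE // e residue_modp.
exists i => f; have [fm|fm] := boolP (coprimep f m); last first.
  by case: cX => _ _ _ -> //; case: (XD i) => _ _ _ ->.
have : c i = chi f * (X i f)^* * c i.
  rewrite {1}/c (sum_residue_mul (fun r => chi r * (X i r)^*) m0 fm) mulr_sumr.
  apply: eq_bigr => r _; case: (cX) (XD i) => _ cM cmod _ [_ XM Xmod _].
  by rewrite cmod Xmod cM XM rmorphM; rewrite mulrACA.
move/eqP; rewrite -[X in X == _]mul1r -subr_eq0 -mulrBl mulf_eq0 (negPf ci) orbF subr_eq0.
move/eqP => e; rewrite -[LHS]mulr1 e mulrCA -normCK X1 // expr1n mulr1 //.
Qed.

End DirichletCharacters.

(** * Agreement with the characters of the statement *)

Section CharacterMod.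
Local Open Scope ring_scope.

Lemma character_modP (R : realType) (F : finFieldType) (m : {poly F}) (chi : arithfun R F) : m != 0 -> (character_mod m chi <-> dirichlet m chi).
Proof.
move=> m0; split=> [[chi0 [c1 cM] cE]|[c1 cM cmod c0]]; last first.
  exists chi; first by split=> [|r s _ _]; rewrite cmod.
  move=> f; case: ifPn => [_|/c0 //]; by rewrite cmod.
split=> [|f g|f|f /negPf fm].
- by rewrite cE coprime1p.
- rewrite !cE coprimepMl; case: ifP => [/andP[fm gm]|]; last first.
    by move/negbT; rewrite negb_and => /orP[] /negPf ->; rewrite ?mul0r ?mulr0.
  rewrite fm gm.
  have := cM (to_residue m f) (to_residue m g); rewrite !to_residueE // modpM.
  by apply; apply: unit_to_residue.
- by rewrite !cE coprimep_modl modp_id.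
- by rewrite cE fm.
Qed.

End CharacterMod.

(** * Primitive characters *)

Section Primitive.
Local Open Scope ring_scope.
Variables (C : numClosedFieldType) (F : finFieldType).
Implicit Types (f g h m d e : {poly F}) (chi : {poly F} -> C).

Lemma eq_modp_dvd m f g : (f %% m == g %% m) = (m %| f - g).
Proof. by rewrite -subr_eq0 -modpN -modpD; apply/eqP/modp_eq0P. Qed.

Lemma eq_modp_dvdr d m f g : d %| m -> f %% m = g %% m -> f %% d = g %% d.
Proof. by move=> dm /eqP fg; apply/eqP; move: fg; rewrite !eq_modp_dvd; apply: dvdp_trans. Qed.

Lemma eq_modp_coprimep m f g : f %% m = g %% m -> coprimep f m = coprimep g m.
Proof. by move=> fg; rewrite -coprimep_modl fg coprimep_modl. Qed.

Lemma eq_modpM m f f' g g' : f %% m = f' %% m -> g %% m = g' %% m ->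
  (f * g) %% m = (f' * g') %% m.
Proof. by move=> ff gg; rewrite -modpM ff gg modpM. Qed.

(** Lifts a unit modulo [d] to a unit modulo a multiple [m]. [gdcop f m] is the largest divisor of
    [m] coprime to [f]: a prime of [m] dividing [f] divides neither [d] nor [gdcop f m], and a prime
    of [m] not dividing [f] divides [gdcop f m], so in both cases it does not divide the sum. *)
Definition unit_lift d m f := f + d * gdcop f m.

Lemma unit_lift_mod d m f : unit_lift d m f %% d = f %% d.
Proof. by rewrite /unit_lift modpD modp_mulr addr0. Qed.

Lemma coprimep_unit_lift d m f : m != 0 -> coprimep f d -> coprimep (unit_lift d m f) m.
Proof.
rewrite /unit_lift => m0 fd; case: gdcopP => u um; rewrite (negPf m0) orbF => uf umax.
set r := _ + _; set h := gcdp r m; have hr : h %| r := dvdp_gcdl _ _.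
have hf : coprimep h f.
  apply/coprimepP => k kh kf.
  have kdu : k %| d * u by rewrite -(dvdp_addr _ kf) (dvdp_trans kh).
  have fdu : coprimep f (d * u) by rewrite coprimepMr fd coprimep_sym.
  by move/coprimepP: fdu; apply.
have hu : h %| u by apply: umax; rewrite ?dvdp_gcdr.
have : h %| f by rewrite -(dvdp_addl _ (dvdp_mull d hu)).
by move=> hf'; rewrite /coprimep -/h; move/coprimepP: hf => /(_ h (dvdpp _) hf'); rewrite -size_poly_eq1.
Qed.

(** If [f] is 1 modulo the gcd, Bezout gives [h] congruent to [f] modulo [m1] and to 1 modulo [m2];
    then [chi1 f = chi1 h = chi2 h = 1]. Hence [chi1] depends only on the class modulo [d], and
    [unit_lift] extends it to everything coprime to [d]. *)
Lemma dirichlet_gcd m1 m2 d chi1 chi2 : m1 != 0 -> m2 != 0 ->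
  d %= gcdp m1 m2 -> dirichlet m1 chi1 -> dirichlet m2 chi2 ->
  (forall f, coprimep f m1 -> coprimep f m2 -> chi1 f = chi2 f) ->
  exists2 chi, dirichlet d chi & forall f, coprimep f m1 -> chi1 f = chi f.
Proof.
move=> m10 m20 dE D1 D2 e12.
have dm1 : d %| m1 by rewrite (eqp_dvdl _ dE) dvdp_gcdl.
have chi11 f : coprimep f m1 -> f %% d = 1 %% d -> chi1 f = 1.
  move=> fm /eqP; rewrite eq_modp_dvd (eqp_dvdl _ dE).
  have [[a b] /= ab] := Bezoutp m1 m2.
  rewrite -(eqp_dvdl _ ab) => /dvdpP[c fc].
  pose h := f - c * a * m1.
  have hf : h %% m1 = f %% m1 by rewrite /h modpD modpN modp_mull oppr0 addr0.
  have hE : h = 1 + c * b * m2.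
    by move/eqP: fc; rewrite subr_eq /h => /eqP ->; ring.
  have h1 : h %% m2 = 1 %% m2 by rewrite hE modpD modp_mull addr0.
  rewrite -(dirichlet_modE D1 hf) e12 ?(eq_modp_coprimep hf) //.
    by rewrite (dirichlet_modE D2 h1); case: D2.
  by rewrite (eq_modp_coprimep h1) coprime1p.
have chi1d f g : coprimep f m1 -> coprimep g m1 -> f %% d = g %% d -> chi1 f = chi1 g.
  move=> fm gm fg; have [h hm gh] := coprimep_inverse m10 gm.
  have ghd : (g * h) %% d = 1 %% d := eq_modp_dvdr dm1 gh.
  have : chi1 (f * h) = 1.
    by apply: chi11; rewrite ?coprimepMl ?fm // -ghd; apply: eq_modpM.
  have : chi1 (g * h) = 1 by apply: chi11; rewrite ?coprimepMl ?gm.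
  case: (D1) => _ M1 _ _; rewrite !M1 => <- e; apply: (mulIf _ e).
  exact: dirichlet_neq0 D1 hm.
have lm f : coprimep f d -> coprimep (unit_lift d m1 f) m1 by apply: coprimep_unit_lift.
exists (fun f => if coprimep f d then chi1 (unit_lift d m1 f) else 0); last first.
  move=> f fm; have fd : coprimep f d by apply: coprimep_dvdl fm.
  by rewrite fd; apply: chi1d; rewrite ?lm ?unit_lift_mod.
split=> [|f g|f|f /negPf -> //].
- by rewrite coprime1p; apply: chi11; rewrite ?unit_lift_mod ?lm ?coprime1p.
- rewrite coprimepMl; case: ifP => [/andP[fm gm]|]; last first.
    by move/negbT; rewrite negb_and => /orP[] /negPf ->; rewrite ?mul0r ?mulr0.
  case: (D1) => _ M1 _ _; rewrite fm gm -M1.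
  apply: chi1d; rewrite ?lm ?coprimepMl ?lm ?fm //.
  by rewrite unit_lift_mod; apply: eq_modpM; rewrite unit_lift_mod.
- rewrite coprimep_modl; case: ifP => // fd.
  by apply: chi1d; rewrite ?lm ?coprimep_modl // !unit_lift_mod modp_id.
Qed.

Definition primitive d chi := forall d' chi', d' \is monic -> d' %| d ->
  dirichlet d' chi' -> (forall f, coprimep f d -> chi f = chi' f) -> (size d <= size d')%N.

Lemma monic_eqp f g : f \is monic -> g \is monic -> f %= g -> f = g.
Proof. by move=> fm gm; rewrite eqp_monic // => /eqP. Qed.

Lemma primitive_dvd d1 d2 chi1 chi2 : d1 \is monic -> d2 \is monic ->
  dirichlet d1 chi1 -> dirichlet d2 chi2 -> primitive d1 chi1 ->
  (forall f, coprimep f d1 -> coprimep f d2 -> chi1 f = chi2 f) -> d1 %| d2.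
Proof.
move=> m1 m2 D1 D2 p1 e12; have n1 := monic_neq0 m1; have n2 := monic_neq0 m2.
pose g := gcdp d1 d2; pose d := (lead_coef g)^-1 *: g.
have g0 : g != 0 by rewrite gcdp_eq0 negb_and n1.
have dE : d %= g by rewrite eqp_scale // invr_neq0 // lead_coef_eq0.
have dm : d \is monic by rewrite monicE lead_coefZ mulVf ?lead_coef_eq0.
have d1d : d %| d1 by rewrite (eqp_dvdl _ dE) dvdp_gcdl.
have [chi D e] := dirichlet_gcd n1 n2 dE D1 D2 e12.
have sz := p1 d chi dm d1d D e.
suff -> : d1 = d by rewrite (eqp_dvdl _ dE) dvdp_gcdr.
apply: monic_eqp => //; rewrite eqp_sym -dvdp_size_eqp //.
by rewrite eqn_leq sz dvdp_leq.
Qed.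

(** Both characters are induced from the gcd of the moduli, so primitivity makes each modulus divide
    the other. Read contrapositively, distinct primitive characters differ at some [g] coprime to
    both moduli, which is what [dirichlet_orthogonal] asks for. *)
Lemma primitive_separated d1 d2 chi1 chi2 : d1 \is monic -> d2 \is monic ->
  dirichlet d1 chi1 -> dirichlet d2 chi2 -> primitive d1 chi1 -> primitive d2 chi2 ->
  (forall f, coprimep f d1 -> coprimep f d2 -> chi1 f = chi2 f) ->
  d1 = d2 /\ chi1 =1 chi2.
Proof.
move=> m1 m2 D1 D2 p1 p2 e12.
have dE : d1 = d2.
  apply: monic_eqp => //; rewrite /eqp (primitive_dvd m1 m2 D1 D2 p1 e12).
  by apply: (primitive_dvd m2 m1 D2 D1 p2) => f f2 f1; rewrite e12.
split=> // f; have [fd|fd] := boolP (coprimep f d1); first by apply: e12; rewrite -?dE.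
by case: D1 D2 => _ _ _ -> // [_ _ _ ->]; rewrite -?dE.
Qed.

End Primitive.

(** * The large sieve *)

Section Bessel.
Local Open Scope ring_scope.
Variables (C : numClosedFieldType).

(** Expansion of the squared norm of [a - b], where [b] has coefficients [S i / w i] on the
    conjugates of the [v i]. As [w i] only dominates the squared norm of [v i], [b] need not be the
    projection of [a], but its squared norm is still at most its inner product with [a], which
    suffices. *)
Lemma bessel (I T : finType) (P : pred I) (v : I -> T -> C) (w : I -> C) (a : T -> C) :
  (forall i, P i -> 0 < w i) ->
  (forall i, P i -> \sum_t `|v i t| ^+ 2 <= w i) ->
  (forall i j, P i -> P j -> i != j -> \sum_t v i t * (v j t)^* = 0) ->
  \sum_(i | P i) `|\sum_t a t * v i t| ^+ 2 / w i <= \sum_t `|a t| ^+ 2.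
Proof.
move=> w0 vw vo.
pose S i := \sum_t a t * v i t.
pose c i := S i / w i.
pose b t := \sum_(i | P i) c i * (v i t)^*.
have wR i : P i -> (w i)^* = w i by move=> /w0 /ltW /geC0_conj.
have ab : \sum_t a t * (b t)^* = \sum_(i | P i) `|S i| ^+ 2 / w i.
  rewrite (eq_bigr (fun t => \sum_(i | P i) (c i)^* * (a t * v i t))); last first.
    move=> t _; rewrite rmorph_sum mulr_sumr; apply: eq_bigr => i _.
    by rewrite rmorphM /= conjCK mulrCA.
  rewrite exchange_big; apply: eq_bigr => i Pi; rewrite -mulr_sumr -/(S i).
  by rewrite /c rmorphM fmorphV /= wR // mulrAC [_ * S i]mulrC -normCK.
have bb : \sum_t `|b t| ^+ 2 <= \sum_(i | P i) `|S i| ^+ 2 / w i.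
  have -> : \sum_t `|b t| ^+ 2 = \sum_(i | P i) `|c i| ^+ 2 * \sum_t `|v i t| ^+ 2.
    rewrite (eq_bigr (fun t => \sum_(i | P i) \sum_(j | P j)
       c i * (c j)^* * (v j t * (v i t)^*))); last first.
      move=> t _; rewrite normCK {2}/b rmorph_sum mulr_suml; apply: eq_bigr => i _.
      rewrite mulr_sumr; apply: eq_bigr => j _; rewrite rmorphM /= conjCK.
      by rewrite mulrACA [v j t * _]mulrC.
    rewrite exchange_big; apply: eq_bigr => i Pi; rewrite exchange_big (bigD1 i) //=.
    rewrite [X in _ + X]big1 ?addr0 => [|j /andP[Pj ji]].
      rewrite -mulr_sumr -normCK; congr (_ * _); apply: eq_bigr => t _; by rewrite normCK.
    by rewrite -mulr_sumr vo ?mulr0.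
  apply: ler_sum => i Pi; rewrite /c normrM exprMn normfV (gtr0_norm (w0 i Pi)).
  rewrite -mulrA ler_wpM2l ?exprn_ge0 ?normr_ge0 // exprVn expr2 invfM -mulrA.
  rewrite -[leRHS]mulr1 ler_pM2l ?invr_gt0 ?w0 // mulrC ler_pdivrMr ?w0 // mul1r.
  exact: vw.
have ba : \sum_t (a t)^* * b t = \sum_(i | P i) `|S i| ^+ 2 / w i.
  transitivity ((\sum_t a t * (b t)^*)^*).
    by rewrite rmorph_sum; apply: eq_bigr => t _; rewrite rmorphM /= conjCK.
  rewrite ab rmorph_sum; apply: eq_bigr => i Pi.
  by rewrite rmorphM rmorphXn fmorphV /= wR // conj_normC.
have : 0 <= \sum_t `|a t - b t| ^+ 2 by apply: sumr_ge0 => t _; rewrite exprn_ge0 ?normr_ge0.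
rewrite (eq_bigr (fun t => `|a t| ^+ 2 - a t * (b t)^* - ((a t)^* * b t - `|b t| ^+ 2))); last first.
  move=> t _; rewrite !normCK rmorphB /= mulrBl !mulrBr.
  by rewrite [(a t)^* * _]mulrC.
rewrite !sumrB ab ba => h; rewrite -subr_ge0; apply: le_trans h _.
by rewrite lerBlDr lerDl subr_ge0.
Qed.

End Bessel.

Section LargeSieve.
Local Open Scope ring_scope.
Variables (C : numClosedFieldType) (F : finFieldType).
Implicit Types (f g h m d e : {poly F}) (chi : {poly F} -> C).

Lemma size_modp_le (L : nat) f m : m != 0 -> (size m <= L.+1)%N -> (size (f %% m)%R <= L)%N.
Proof. by move=> m0 mL; rewrite -ltnS; apply: leq_trans mL; rewrite ltn_modp. Qed.

(* Both characters are periodic modulo [M := d1 * d2], and [{poly_L F}] is a union of complete residue systems modulo [M]; so multiplication by [g] modulo [M] permutes it. *)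
Lemma dirichlet_orthogonal (L : nat) d1 d2 chi1 chi2 g :
  d1 != 0 -> d2 != 0 -> (size (d1 * d2)%R <= L.+1)%N ->
  dirichlet d1 chi1 -> dirichlet d2 chi2 ->
  coprimep g d1 -> coprimep g d2 -> `|chi2 g| = 1 -> chi1 g != chi2 g ->
  \sum_(f : {poly_L F}) chi1 f * (chi2 f)^* = 0.
Proof.
move=> d10 d20; set M := d1 * d2 => ML D1 D2 g1 g2 n2 ne.
have M0 : M != 0 by rewrite mulf_neq0.
have gM : coprimep g M by rewrite coprimepMr g1.
(* The remainder modulo [M] is multiplied by [g] and the multiple of [M] is kept, so that degrees
   stay below [L]. *)
pose h f := f - f %% M + (g * f) %% M.
pose H (f : {poly_L F}) : {poly_L F} := npolyp L (h f).
have HE (f : {poly_L F}) : H f = h f :> {poly F}.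
  apply: npolypK; rewrite /h; apply: leq_trans (size_polyD _ _) _.
  rewrite geq_max size_modp_le // andbT; apply: leq_trans (size_polyD _ _) _.
  by rewrite geq_max size_npoly size_polyN size_modp_le.
have hM f : h f %% M = (g * f) %% M.
  by rewrite /h modpD modpD modpN !modp_id subrr add0r.
have HI : injective H.
  move=> f f' /(congr1 (fun x : {poly_L F} => x : {poly F})); rewrite !HE => e.
  have /eqP : (g * f) %% M = (g * f') %% M by rewrite -!hM e.
  rewrite eq_modp_dvd -mulrBr Gauss_dvdpr; last by rewrite coprimep_sym.
  rewrite -eq_modp_dvd => /eqP fm; apply/val_inj => /=.
  by move: e; rewrite /h fm -(modp_mul g f) fm modp_mul => /addIr /addIr.
have : \sum_(f : {poly_L F}) chi1 f * (chi2 f)^* =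
       chi1 g * (chi2 g)^* * \sum_(f : {poly_L F}) chi1 f * (chi2 f)^*.
  rewrite {1}(reindex_inj HI) mulr_sumr; apply: eq_bigr => f _; rewrite HE.
  have e1 : h f %% d1 = (g * f) %% d1.
    by apply: eq_modp_dvdr (hM f); rewrite dvdp_mulr.
  have e2 : h f %% d2 = (g * f) %% d2.
    by apply: eq_modp_dvdr (hM f); rewrite dvdp_mull.
  rewrite (dirichlet_modE D1 e1) (dirichlet_modE D2 e2).
  by case: D1 D2 => _ M1 _ _ [_ M2 _ _]; rewrite M1 M2 rmorphM mulrACA.
move/eqP; rewrite -[X in X == _]mul1r -subr_eq0 -mulrBl mulf_eq0 subr_eq0.
case/orP => /eqP // e; case/eqP: ne.
by rewrite -[LHS]mulr1 -(expr1n _ 2) -n2 normCK mulrCA -e mulr1.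
Qed.

(** Division by [d] sends [f] to a quotient and a unit residue, injectively. This count is the
    squared norm of a character modulo [d] on degrees < [L]; it puts the weight [phi d] into the
    large sieve. *)
Lemma card_coprime_npoly (L : nat) d : d != 0 -> (size d <= L.+1)%N ->
  (#|[pred f : {poly_L F} | coprimep (f : {poly F}) d]| <= #|F| ^ (L.+1 - size d) * phi d)%N.
Proof.
move=> d0 dL; rewrite -card_npoly /phi -cardX.
pose h (f : {poly_L F}) : {poly_(L.+1 - size d) F} * residue d :=
  (npolyp _ ((f : {poly F}) %/ d), to_residue d f).
have hE (f : {poly_L F}) : (h f).1 = f %/ d :> {poly F}.
  apply: npolypK; rewrite size_divp //.
  apply: leq_trans (leq_sub2r _ (size_npoly f)) _.
  by rewrite -[X in (_ <= _ - X)%N]prednK ?size_poly_gt0.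
have hI : injective h.
  move=> f f' e; apply/val_inj => /=.
  rewrite (divp_eq f d) (divp_eq f' d) -!hE e -!to_residueE //.
  by have -> : to_residue d f = to_residue d f' by case: e.
rewrite -(card_imset _ hI); apply: subset_leq_card; apply/subsetP => _ /imsetP[f fd ->].
by rewrite !inE /=; apply: unit_to_residue.
Qed.

Lemma phi_gt0 d : d != 0 -> (0 < phi d)%N.
Proof.
by move=> d0; apply/card_gt0P; exists (to_residue d 1); apply: (unit_to_residue d0 (coprime1p d)).
Qed.

Lemma large_sieve (I : finType) (P : pred I) (k L : nat) (d : I -> {poly F})
    (chi : I -> {poly F} -> C) (a : {poly F} -> C) :
  (2 * k <= L)%N ->
  (forall i, P i -> [/\ d i \is monic, size (d i) = k.+1, dirichlet (d i) (chi i) &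
     primitive (d i) (chi i)]) ->
  (forall i, P i -> forall f, coprimep f (d i) -> `|chi i f| = 1) ->
  (forall i j, P i -> P j -> d i = d j -> chi i =1 chi j -> i = j) ->
  \sum_(i | P i) `|\sum_(f : {poly_L F}) a f * chi i f| ^+ 2 / (phi (d i))%:R
    <= (#|F| ^ (L - k))%:R * \sum_(f : {poly_L F}) `|a f| ^+ 2.
Proof.
move=> kL dP n1 inj.
have c0 : 0 < (#|F| ^ (L - k))%:R :> C.
  by rewrite ltr0n expn_gt0 (ltn_trans _ (card_finNzRing_gt1 F)).
rewrite -ler_pdivrMl // mulr_sumr.
rewrite (eq_bigr (fun i => `|\sum_(f : {poly_L F}) a f * chi i f| ^+ 2 /
    ((#|F| ^ (L - k))%:R * (phi (d i))%:R))); last first.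
  by move=> i _; rewrite invfM mulrCA mulrA.
apply: (@bessel _ _ _ P (fun i (f : {poly_L F}) => chi i f) _ (fun f : {poly_L F} => a f)).
- by move=> i /dP[dm _ _ _]; rewrite mulr_gt0 // ltr0n phi_gt0 ?monic_neq0.
- move=> i Pi; have [dm ds D _] := dP i Pi.
  rewrite (bigID (fun f : {poly_L F} => coprimep f (d i))) /= [X in _ + X]big1 ?addr0; last first.
    by move=> f fd; case: D => _ _ _ ->; rewrite ?normr0 ?expr0n.
  rewrite (eq_bigr (fun=> 1)); last by move=> f fd; rewrite n1 ?expr1n.
  rewrite sumr_const -natrM ler_nat.
  have := @card_coprime_npoly L (d i) (monic_neq0 dm); rewrite ds subSS; apply.
  by rewrite ltnS (leq_trans _ kL) // mul2n -addnn leq_addr.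
- move=> i j Pi Pj ij; have [dmi dsi Di pi] := dP i Pi; have [dmj dsj Dj pj] := dP j Pj.
  have [g [gi gj ne]] : exists g, [/\ coprimep g (d i), coprimep g (d j) & chi i g != chi j g].
    apply/not_existsP => h.
    have e f : coprimep f (d i) -> coprimep f (d j) -> chi i f = chi j f.
      by move=> fi fj; apply/eqP/negPn/negP => ne; apply: (h f); split.
    have [de ce] := primitive_separated dmi dmj Di Dj pi pj e.
    by move: ij; rewrite (inj i j Pi Pj de ce) eqxx.
  apply: (dirichlet_orthogonal _ _ _ Di Dj gi gj (n1 j Pj g gj) ne); rewrite ?monic_neq0 //.
  by rewrite size_monicM ?monic_neq0 // dsi dsj addSn addnS /= addnn -mul2n ltnS.
Qed.

End LargeSieve.

(** * Divisor function and Euler function *)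

Section MonicSums.
Local Open Scope ring_scope.
Variables (F : finFieldType).
Implicit Types (f g h m d e : {poly F}).

Lemma npoly_inj n : injective (fun f : {poly_n F} => f : {poly F}).
Proof. exact: val_inj. Qed.

Lemma monic_degP n f : reflect (f \is monic /\ size f = n.+1) (monic_deg n f).
Proof. by apply: (iffP andP) => -[fm /eqP fs]. Qed.

Lemma sum_npoly_widen (V : nmodType) (n n' : nat) (P : pred {poly F}) (u : {poly F} -> V) :
  (n <= n')%N -> (forall f, P f -> (size f <= n)%N) ->
  \sum_(f : {poly_n F} | P f) u f = \sum_(f : {poly_n' F} | P f) u f.
Proof.
move=> nn' Pn; rewrite (reindex_onto (fun f : {poly_n F} => npolyp n' f)
   (fun f : {poly_n' F} => npolyp n f)) /=; last first.
  by move=> f Pf; apply: npoly_inj; rewrite npolypK npolypK ?Pn ?size_npoly.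
have e (f : {poly_n F}) : npolyp n' f = f :> {poly F}.
  by rewrite npolypK // (leq_trans (size_npoly f)).
apply: eq_big => [f|f _]; rewrite e //.
suff -> : npolyp n f == f by rewrite andbT.
by apply/eqP/npoly_inj; rewrite npolypK // size_npoly.
Qed.

Lemma monicM_size g h : g \is monic -> h \is monic ->
  (size (g * h)%R = ((size g).-1 + (size h).-1).+1)%N.
Proof.
move=> gm hm; rewrite size_monicM ?monic_neq0 //.
have := size_poly_gt0 g; have := size_poly_gt0 h; rewrite !monic_neq0 //.
by case: (size g) => // a; case: (size h) => // b _ _; rewrite addSn addnS.
Qed.

(** The double sum of [dconv] with an arbitrary function of the pair, so that [tau], its moments and
    twisted convolutions share one rearrangement. *)
Definition divisor_sum (V : nmodType) (G : {poly F} -> {poly F} -> V) f :=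
  \sum_(g : {poly_(size f) F} | (g : {poly F}) \is monic)
    \sum_(h : {poly_(size f) F} | ((h : {poly F}) \is monic) && ((g : {poly F}) * h == f)) G g h.

Lemma sum_divisor_sum (V : nmodType) (G : {poly F} -> {poly F} -> V) (M : nat) :
  \sum_(f : {poly_M.+1 F} | monic_deg M f) divisor_sum G f =
  \sum_(a < M.+1) \sum_(g : {poly_a.+1 F} | monic_deg a g)
    \sum_(h : {poly_(M - a).+1 F} | monic_deg (M - a) h) G g h.
Proof.
transitivity (\sum_(g : {poly_M.+1 F} | (g : {poly F}) \is monic)
   \sum_(h : {poly_M.+1 F} | ((h : {poly F}) \is monic) && monic_deg M ((g : {poly F}) * h)) G g h).
  transitivity (\sum_(f : {poly_M.+1 F} | monic_deg M f)
    \sum_(g : {poly_M.+1 F} | (g : {poly F}) \is monic)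
    \sum_(h : {poly_M.+1 F} | ((h : {poly F}) \is monic) && ((g : {poly F}) * h == f)) G g h).
    by apply: eq_bigr => f /monic_degP[_ fs]; rewrite /divisor_sum fs.
  rewrite exchange_big; apply: eq_bigr => g gm /=.
  rewrite (exchange_big_dep (fun h : {poly_M.+1 F} => (h : {poly F}) \is monic)) /=; last by move=> f h _ /andP[].
  rewrite big_mkcondr; apply: eq_bigr => h hm.
  rewrite hm /=; case: ifPn => [gh|gh].
    have fE : npolyp M.+1 ((g : {poly F}) * h) = (g : {poly F}) * h :> {poly F}.
      by rewrite npolypK //; case/monic_degP: gh => _ ->.
    rewrite (big_pred1 (npolyp M.+1 ((g : {poly F}) * h))) // => f.
    apply/andP/eqP => [[_ /eqP e]|->]; last by rewrite fE eqxx.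
    by apply: npoly_inj; rewrite fE e.
  by rewrite big_pred0 // => f; apply/andP => -[fm /eqP e]; rewrite e fm in gh.
have szg (g : {poly_M.+1 F}) : (g : {poly F}) \is monic -> (0 < size g <= M.+1)%N.
  by move=> gm; rewrite size_npoly size_poly_gt0 monic_neq0.
rewrite (partition_big (fun g : {poly_M.+1 F} => inord (size g).-1 : 'I_M.+1) xpredT) //=.
apply: eq_bigr => a _.
have aM : (a <= M)%N by rewrite -ltnS.
rewrite (@sum_npoly_widen _ a.+1 M.+1 (fun g => monic_deg a g) (fun g => \sum_(h : {poly_(M - a).+1 F} | monic_deg (M - a) h) G g h)) //; last by move=> f /monic_degP[_ ->].
apply: eq_big => [g|g /andP[gm /eqP ga]].
  rewrite /monic_deg; have [gm|//] := boolP ((g : {poly F}) \is monic); rewrite /=.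
  have /andP[g0 gM] := szg g gm.
  rewrite -val_eqE /= inordK ?prednK // -(eqn_add2r 1) !addn1 prednK //.
have /andP[g0 gM] := szg g gm.
have gs : (size g).-1 = a by rewrite -ga inordK // prednK.
rewrite (@sum_npoly_widen _ (M - a).+1 M.+1 (fun h => monic_deg (M - a) h) (G g)) //; last 2 first.
- by rewrite ltnS leq_subr.
- by move=> f /monic_degP[_ ->].
apply: eq_bigl => h; rewrite /monic_deg.
have [hm|//] := boolP ((h : {poly F}) \is monic); rewrite /= monicMl // hm /=.
rewrite monicM_size // eqSS gs.
have h0 : (0 < size h)%N by rewrite size_poly_gt0 monic_neq0.
rewrite -[X in _ = (X == _)]prednK // eqSS.
by apply/eqP/eqP => [e|->]; [rewrite -[LHS](addKn a) e | rewrite subnKC].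
Qed.

Lemma inner_divisor_sum (V : nmodType) (G : {poly F} -> V) f g : f \is monic -> g \is monic ->
  \sum_(h : {poly_(size f) F} | ((h : {poly F}) \is monic) && (g * h == f)) G h =
  if g %| f then G (f %/ g) else 0.
Proof.
move=> fm gm; case: ifPn => [gf|gf]; last first.
  rewrite big_pred0 // => h; apply/andP => -[_ /eqP e].
  by rewrite -e dvdp_mulr in gf.
have g0 := monic_neq0 gm; have f0 := monic_neq0 fm.
have fE : g * (f %/ g) = f by rewrite mulrC divpK.
have sz : (size (f %/ g)%R <= size f)%N by rewrite leq_divp.
rewrite (big_pred1 (npolyp (size f) (f %/ g))) ?npolypK // => h.
apply/andP/eqP => [[_ /eqP e]|->]; last first.
  by rewrite npolypK // -(monicMl (f %/ g) gm) fE.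
by apply: npoly_inj; rewrite npolypK //; apply: (mulfI g0); rewrite fE.
Qed.

Lemma tauE (V : pzSemiRingType) f : f \is monic -> (tau f)%:R = divisor_sum (fun _ _ => 1 : V) f.
Proof.
move=> fm; rewrite /divisor_sum /tau -sum1_card natr_sum big_mkcondr /=.
by apply: eq_bigr => g gm; rewrite (inner_divisor_sum (fun=> 1)).
Qed.

Lemma tau_gt0 f : f \is monic -> (0 < tau f)%N.
Proof.
move=> fm; apply/card_gt0P; exists (npolyp (size f) f).
by rewrite inE npolypK // fm dvdpp.
Qed.

Lemma tau_dvd f g : f \is monic -> g %| f -> (tau g <= tau f)%N.
Proof.
move=> fm gf; have f0 := monic_neq0 fm.
pose h (k : {poly_(size g) F}) : {poly_(size f) F} := npolyp _ k.
have hE (k : {poly_(size g) F}) : h k = k :> {poly F}.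
  by rewrite npolypK // (leq_trans (size_npoly k)) // dvdp_leq.
have hI : injective h by move=> k l /(congr1 val) /= ; rewrite !hE => /val_inj.
rewrite /tau -(card_imset _ hI); apply: subset_leq_card; apply/subsetP => _ /imsetP[k kg ->].
by move: kg; rewrite !inE hE => /andP[-> kg]; apply: dvdp_trans kg gf.
Qed.

Definition mgcd f g := (lead_coef (gcdp f g))^-1 *: gcdp f g.

Lemma mgcdP f g : g != 0 ->
  [/\ mgcd f g \is monic, mgcd f g %| f, mgcd f g %| g & coprimep (f %/ mgcd f g) (g %/ mgcd f g)].
Proof.
move=> g0; have G0 : gcdp f g != 0 by rewrite gcdp_eq0 negb_and g0 orbT.
have c0 : (lead_coef (gcdp f g))^-1 != 0 by rewrite invr_neq0 // lead_coef_eq0.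
rewrite /mgcd; split; rewrite ?dvdpZl ?dvdp_gcdl ?dvdp_gcdr //.
  by rewrite monicE lead_coefZ mulVf ?lead_coef_eq0.
rewrite !(divpZr _ _ c0) (coprimepZl _ _ (invr_neq0 c0)) (coprimepZr _ _ (invr_neq0 c0)).
by rewrite coprimep_div_gcd // g0 orbT.
Qed.

(** A divisor [k] of [g * h] is recovered from [gcd(k, g)] and [k / gcd(k, g)]; the latter is
    coprime to [g / gcd(k, g)] and therefore divides [h]. *)
Lemma tauM g h : g \is monic -> h \is monic -> (tau (g * h)%R <= tau g * tau h)%N.
Proof.
move=> gm hm; have g0 := monic_neq0 gm; have h0 := monic_neq0 hm.
pose k1 (k : {poly F}) := mgcd k g.
pose H (k : {poly_(size (g * h)%R) F}) : {poly_(size g) F} * {poly_(size h) F} :=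
  (npolyp _ (k1 k), npolyp _ (k %/ k1 k)).
have HP (k : {poly_(size (g * h)%R) F}) : k %| g * h ->
    [/\ (H k).1 = k1 k :> {poly F}, (H k).2 = k %/ k1 k :> {poly F} & k %/ k1 k %| h].
  move=> kgh; have [Dm Dk Dg cop] := mgcdP k g0; have D0 := monic_neq0 Dm.
  have kh : k %/ k1 k %| h.
    rewrite -(Gauss_dvdpr _ cop) -(dvdp_mul2r _ _ D0) divpK //.
    by rewrite mulrAC divpK.
  by split=> //; rewrite npolypK // dvdp_leq.
rewrite {3}/tau {2}/tau -cardX /tau.
have HI : {in [pred k : {poly_(size (g * h)%R) F} | ((k : {poly F}) \is monic) && (k %| g * h)] &, injective H}.
  move=> k l; rewrite !inE => /andP[_ kd] /andP[_ ld] e; apply: npoly_inj.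
  have [k1E k2E _] := HP k kd; have [l1E l2E _] := HP l ld.
  have [_ Dk _ _] := mgcdP k g0; have [_ Dl _ _] := mgcdP l g0.
  by rewrite -(divpK Dk) -(divpK Dl) -/(k1 k) -/(k1 l) -k2E -k1E -l2E -l1E e.
rewrite -(card_in_imset HI); apply: subset_leq_card; apply/subsetP => _ /imsetP[k kg ->].
move: kg; rewrite inE => /andP[km kd]; have [k1E k2E kh] := HP k kd.
have [Dm Dk Dg _] := mgcdP k g0.
rewrite !inE k1E k2E Dm Dg kh /= andbT.
by rewrite -(monicMr _ Dm) divpK.
Qed.

Lemma card_monic_deg n : (#|[pred f : {poly_n.+1 F} | monic_deg n f]| <= #|F| ^ n)%N.
Proof.
rewrite -card_npoly.
(* [npolyp] truncates here: it drops the leading coefficient, which is known to be 1. *)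
pose h (f : {poly_n.+1 F}) : {poly_n F} := npolyp n f.
have hI : {in [pred f : {poly_n.+1 F} | monic_deg n f] &, injective h}.
  move=> f g; rewrite !inE => /monic_degP[fm fs] /monic_degP[gm gs] e.
  apply/npoly_inj/polyP => i; have [ni|] := ltnP i n.
    by have := congr1 (fun k : {poly_n F} => k`_i) e; rewrite !coef_npolyp ni.
  rewrite leq_eqVlt => /predU1P[<-|ni].
    by move: (monicP fm) (monicP gm); rewrite !lead_coefE fs gs /= => -> ->.
  by rewrite !nth_default ?fs ?gs.
by rewrite -(card_in_imset hI) max_card.
Qed.

(* Induction on [k]: [tau f] counts the factorizations [f = g * h], and [tau f <= tau g * tau h] for each of them. *)
Lemma tau_moment (R : realFieldType) (k b : nat) :
  \sum_(f : {poly_b.+1 F} | monic_deg b f) (tau f)%:R ^+ k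
    <= #|F|%:R ^+ b * b.+1%:R ^+ (2 ^ k).-1 :> R.
Proof.
elim: k b => [|k IH] b.
  rewrite expn0 expr0 mulr1.
  under eq_bigr do rewrite expr0.
  by rewrite sumr_const -natrX ler_nat card_monic_deg.
pose T (c : nat) : R := \sum_(f : {poly_c.+1 F} | monic_deg c f) (tau f)%:R ^+ k.
have T0 c : 0 <= T c by apply: sumr_ge0 => f _; rewrite exprn_ge0 ?ler0n.
apply: (@le_trans _ _ (\sum_(a < b.+1) T a * T (b - a)%N)).
  rewrite (eq_bigr (fun a : 'I_b.+1 => \sum_(g : {poly_a.+1 F} | monic_deg a g)
    \sum_(h : {poly_(b - a).+1 F} | monic_deg (b - a) h) (tau g)%:R ^+ k * (tau h)%:R ^+ k)); last first.
    by move=> a _; rewrite mulr_suml; apply: eq_bigr => g _; rewrite mulr_sumr.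
  rewrite -(sum_divisor_sum (fun g h => (tau g)%:R ^+ k * (tau h)%:R ^+ k)).
  apply: ler_sum => f /monic_degP[fm fs].
  rewrite exprS [X in X * _](tauE _ fm) /divisor_sum mulr_suml; apply: ler_sum => g gm.
  rewrite mulr_suml; apply: ler_sum => h /andP[hm /eqP gh].
  rewrite mul1r -exprMn -natrM; apply: lerXn2r; rewrite ?nnegrE ?ler0n //.
  by rewrite ler_nat; have := tauM gm hm; rewrite gh.
have Tb (a : 'I_b.+1) : T a * T (b - a)%N <= #|F|%:R ^+ b * b.+1%:R ^+ (2 * (2 ^ k).-1).
  have ab : (a <= b)%N by rewrite -ltnS.
  have B c : (c <= b)%N -> T c <= #|F|%:R ^+ c * b.+1%:R ^+ (2 ^ k).-1.
    move=> cb; apply: le_trans (IH c) _; rewrite ler_wpM2l ?exprn_ge0 ?ler0n //.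
    by apply: lerXn2r; rewrite ?nnegrE ?ler0n // ler_nat ltnS.
  apply: le_trans (ler_pM (T0 _) (T0 _) (B _ ab) (B _ (leq_subr a b))) _.
  by rewrite mulrACA -exprD subnKC // -exprD addnn mul2n.
apply: le_trans (ler_sum _ (fun a _ => Tb a)) _.
rewrite sumr_const card_ord -[_ *+ b.+1]mulr_natr -mulrA -exprSr.
(* The exponents satisfy e(k + 1) = 2 e(k) + 1, the extra 1 counting the [b.+1] splittings of the
   degree. *)
suff -> : (2 * (2 ^ k).-1).+1 = (2 ^ k.+1).-1 by [].
rewrite expnS; have : (0 < 2 ^ k)%N by rewrite expn_gt0.
by case: (2 ^ k)%N => // c _; rewrite mulnS.
Qed.

(** A residue [r] is determined by [g = gcd(r, e)] together with the unit [r / g] modulo [e / g],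
    and [unit_lift] turns that unit into one modulo [e]. So residues inject into pairs of a divisor
    and a unit. *)
Lemma tau_phi_ge e : e \is monic -> (#|F| ^ (size e).-1 <= tau e * phi e)%N.
Proof.
move=> em; have e0 := monic_neq0 em.
rewrite -card_npoly /tau /phi -cardX -[X in (X <= _)%N]cardsT.
pose h (r : residue e) : {poly_(size e) F} * residue e :=
  (npolyp _ (mgcd r e), to_residue e (unit_lift (e %/ mgcd r e) e (r %/ mgcd r e))).
have hE (r : residue e) : (h r).1 = mgcd r e :> {poly F}.
  by rewrite npolypK // dvdp_leq //; case: (mgcdP r e0).
have hI : injective h.
  move=> r s rs; have /(congr1 val) /= := congr1 fst rs; rewrite !hE => D.
  have /(congr1 (@polyn _ _)) := congr1 snd rs; rewrite !to_residueE // D.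
  have [Dm Dr De _] := mgcdP r e0; have [_ Ds _ _] := mgcdP s e0.
  have D0 := monic_neq0 Dm; rewrite D in Dr De Dm D0.
  set d := mgcd s e in D Dr Ds De Dm D0 *; set e' := e %/ d.
  move/(@eq_modp_dvdr _ e' e) => /(_ (divp_dvd De)); rewrite !unit_lift_mod => rse.
  have small (t : residue e) : d %| t -> (t %/ d) %% e' = t %/ d.
    move=> dt; apply: modp_small; rewrite !size_divp // ltn_sub2r //.
      by rewrite prednK ?size_poly_gt0 // dvdp_leq.
    by rewrite -[X in (_ < X)%N]prednK ?size_poly_gt0 // ltnS size_npoly.
  apply: npoly_inj; rewrite -(divpK Dr) -(divpK Ds).
  by rewrite -(small r Dr) rse small.
rewrite -(card_imset _ hI); apply: subset_leq_card; apply/subsetP => _ /imsetP[r _ ->].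
have [Dm Dr De cop] := mgcdP r e0.
by rewrite !inE hE Dm De; apply: unit_to_residue => //; apply: coprimep_unit_lift.
Qed.

(** Pairs of units inject into the units modulo [d * e]. A lift of the unit modulo [d] is multiplied
    by [z y = 1 + d * (y - w)], where [w] inverts [d] modulo the largest divisor [u] of [e] coprime
    to [d]. As [z y] is 1 modulo [d], a common factor of [z y] and [e] divides [u], where [z y] is
    congruent to [d * y]; so there is none. Modulo [d * e], [z y] determines [y] modulo [e]. *)
Lemma phiM_ge d e : d != 0 -> e != 0 -> (phi d * phi e <= phi (d * e)%R)%N.
Proof.
move=> d0 e0; have de0 : d * e != 0 by rewrite mulf_neq0.
have [u [ue ud umax]] : exists u, [/\ u %| e, coprimep u d &
    forall k, k %| e -> coprimep k d -> k %| u].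
  by exists (gdcop d e); case: gdcopP => u ue; rewrite (negPf e0) orbF => ud um; split.
have u0 : u != 0 by apply: contraNneq e0 => u0; rewrite -dvd0p -u0.
have [w _ dw] : exists2 w, coprimep w u & (d * w) %% u = 1 %% u.
  by apply: coprimep_inverse => //; rewrite coprimep_sym.
pose z (y : {poly F}) := 1 + d * (y - w).
have zc y : coprimep y e -> coprimep (z y) (d * e).
  move=> ye; have zd : coprimep (z y) d.
    by rewrite (@eq_modp_coprimep _ _ _ 1) ?coprime1p // modpD modp_mulr addr0.
  rewrite coprimepMr zd /=; set k := gcdp (z y) e.
  have kd : coprimep k d by apply: coprimep_dvdr zd; apply: dvdp_gcdl.
  have ku : k %| u by apply: umax; rewrite ?dvdp_gcdr.
  have : k %| d * y.
    have -> : d * y = z y + (d * w - 1) by rewrite /z; ring.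
    rewrite dvdp_add ?dvdp_gcdl // (dvdp_trans ku) // -eq_modp_dvd; exact/eqP.
  rewrite Gauss_dvdpr // => ky.
  by move/coprimepP: ye => /(_ k ky (dvdp_gcdr _ _)); rewrite -size_poly_eq1.
pose h (p : residue d * residue e) : residue (d * e) :=
  to_residue (d * e) (unit_lift d (d * e) p.1 * z p.2).
have hI : {in [pred p | unit_residue p.1 && unit_residue p.2] &, injective h}.
  move=> [r y] [s x]; rewrite !inE /= => /andP[rd ye] /andP[sd xe] /(congr1 (@polyn _ _)).
  rewrite !unit_residueE // in rd ye sd xe; rewrite !to_residueE //= => e1.
  have zd t : z t %% d = 1 %% d by rewrite modpD modp_mulr addr0.
  have rs : r = s.
    apply: npoly_inj; rewrite -(residue_modp r d0) -(residue_modp s d0).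
    have := eq_modp_dvdr (dvdp_mulr e (dvdpp d)) e1.
    rewrite (eq_modpM (unit_lift_mod _ _ _) (zd _)) mulr1.
    by rewrite (eq_modpM (unit_lift_mod _ _ _) (zd _)) mulr1.
  move: e1; rewrite rs => /eqP; rewrite eq_modp_dvd -mulrBr Gauss_dvdpr; last first.
    by rewrite coprimep_sym coprimep_unit_lift.
  rewrite /z opprD addrACA subrr add0r -mulrBr opprB addrA subrK dvdp_mul2l //.
  rewrite -eq_modp_dvd !residue_modp // => /eqP yx.
  by congr (_, _); apply/val_inj.
have -> : (phi d * phi e = #|[pred p : residue d * residue e | unit_residue p.1 && unit_residue p.2]|)%N.
  by rewrite /phi -cardX; apply: eq_card.
rewrite -(card_in_imset hI); apply: subset_leq_card; apply/subsetP => _ /imsetP[[r y] + ->].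
rewrite inE /= => /andP[rd ye]; rewrite !unit_residueE // in rd ye.
by apply: unit_to_residue => //; rewrite coprimepMl coprimep_unit_lift // zc.
Qed.

(** By [tau_phi_ge], 1 / phi(e) is at most tau(e) / q^n, and the first moment of [tau] is at most
    q^n (n + 1). *)
Lemma sum_inv_phi (R : realFieldType) (n : nat) :
  \sum_(e : {poly_n.+1 F} | monic_deg n e) (phi e)%:R^-1 <= n.+1%:R :> R.
Proof.
have q0 : 0 < #|F|%:R ^+ n :> R by rewrite exprn_gt0 // ltr0n (ltn_trans _ (card_finNzRing_gt1 F)).
have := tau_moment R 1 n; rewrite expn1 expr1 => tm.
rewrite -(ler_pM2l q0); apply: le_trans tm; rewrite mulr_sumr; apply: ler_sum => e /monic_degP[em es].
rewrite expr1 ler_pdivrMr; last first.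
  rewrite ltr0n; apply/card_gt0P; exists (to_residue e 1).
  exact: (unit_to_residue (monic_neq0 em) (coprime1p e)).
by rewrite -natrX -natrM ler_nat; have := tau_phi_ge em; rewrite es.
Qed.

End MonicSums.

(** * Natural-exponent forms of the three properties *)

Section ComplexNorm.
Local Open Scope ring_scope.
Variable R : rcfType.
Implicit Types z w : R[i].

Lemma normcE z : `|z| = (Normc.normc z)%:C%C.
Proof. by rewrite normc_def; case: z => a b. Qed.

Lemma normc_ge0 z : 0 <= Normc.normc z.
Proof. by case: z => a b; apply: sqrtr_ge0. Qed.

Lemma normc_sum (I : Type) (r : seq I) (P : pred I) (u : I -> R[i]) :
  Normc.normc (\sum_(i <- r | P i) u i) <= \sum_(i <- r | P i) Normc.normc (u i).
Proof.
elim/big_rec2: _ => [|i x y _ xy]; first by rewrite Normc.normc0.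
by apply: le_trans (le_normcD _ _) _; rewrite lerD2l.
Qed.

Lemma normc_eq1 z : `|z| = 1 -> Normc.normc z = 1.
Proof. by rewrite normcE => /(congr1 (@complex.Re R)). Qed.

Lemma normc_conj z : Normc.normc z^* = Normc.normc z.
Proof. by have := norm_conjC z; rewrite !normcE => /(congr1 (@complex.Re R)). Qed.

Lemma normc_real (x : R) : 0 <= x -> Normc.normc x%:C%C = x.
Proof. by move=> x0; rewrite /= expr0n addr0 sqrtr_sqr ger0_norm. Qed.

Lemma normc_nat n : Normc.normc (n%:R : R[i]) = n%:R.
Proof.
have -> : (n%:R : R[i]) = (n%:R : R)%:C%C by rewrite rmorph_nat.
by rewrite normc_real.
Qed.

End ComplexNorm.

Section Reformulation.
Local Open Scope ring_scope.
Variables (R : realType) (F : finFieldType).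
Implicit Types (psi : arithfun R F) (N : nat).
Local Notation q := (qR R F).

Lemma q_gt1 : 1 < q.
Proof. by rewrite /qR ltr1n card_finNzRing_gt1. Qed.

Lemma q_gt0 : 0 < q.
Proof. exact: lt_trans q_gt1. Qed.

Definition twisted_sum psi N (w : {poly F} -> R[i]) : R[i] :=
  \sum_(f : {poly_N.+1 F} | monic_deg N f) psi f * w f.

Definition nat_growth psi := exists (c : nat) (K : R), 0 <= K /\
  forall f : {poly F}, f \is monic -> Normc.normc (psi f) <= K * (tau f)%:R ^+ c.

(* For natural [D], [deg d <= D log N] reads [q ^ deg d <= N ^ D]; likewise [deg m <= N / 2 - B log N] in [small_modulus]. *)
Definition siegel_walfisz_bound psi (D : nat) (K : R) :=
  forall (N : nat) (m d : {poly F}) (chi : arithfun R F),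
    (0 < N)%N -> (1 < size m)%N -> character_mod m chi ->
    ~ principal_mod m chi -> is_conductor m chi d ->
    (#|F| ^ (size d).-1 <= N ^ D)%N ->
    Normc.normc (twisted_sum psi N chi) * N%:R ^+ (3 * D) <= K * q ^+ N.

Definition nat_siegel_walfisz psi := exists D0 : nat, forall D, (D0 <= D)%N ->
  exists K : R, 0 <= K /\ siegel_walfisz_bound psi D K.

Definition small_modulus (N B : nat) (m : {poly F}) :=
  (m \is monic) && (#|F| ^ (2 * (size m).-1) * N ^ (2 * B) <= #|F| ^ N)%N.

Definition nat_bombieri_vinogradov psi := forall A : nat,
  exists (B : nat) (K : R), 0 <= K /\ forall N, (0 < N)%N ->
    (\sum_(m : {poly_N.+1 F} | small_modulus N B m) bvE_max N m psi) * N%:R ^+ A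
      <= K * q ^+ N.

(** Exponents can be rounded up because [tau f >= 1] for monic [f]. *)
Lemma growthP psi : growth_condition psi <-> nat_growth psi.
Proof.
split=> [[C C0 [K hK]]|[c [K [K0 hK]]]].
  exists (Num.bound C), `|K|; split=> // f fm; apply: le_trans (hK f fm) _.
  have t1 : 1 <= (tau f)%:R :> R by rewrite ler1n tau_gt0.
  apply: le_trans (ler_wpM2r (powR_ge0 _ _) (ler_norm K)) _; rewrite ler_wpM2l //.
  by rewrite -powR_mulrn ?ler0n //; apply: ler_powR => //; apply/ltW/archi_boundP/ltW.
exists c.+1%:R; first by rewrite ltr0n.
exists K => f fm; apply: le_trans (hK f fm) _; rewrite ler_wpM2l // powR_mulrn ?ler0n //.
by rewrite ler_weXn2l // ler1n tau_gt0.
Qed.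

Lemma logq_cond (k N D : nat) : (0 < N)%N ->
  (k%:R <= D%:R * logq F (N%:R : R)) = (#|F| ^ k <= N ^ D)%N.
Proof.
move=> N0; have lq : 0 < ln (qR R F) by rewrite ln_gt0 // q_gt1.
rewrite /logq mulrA ler_pdivlMr // !mulr_natl -!lnXn ?q_gt0 ?ltr0n //.
by rewrite ler_ln ?posrE ?exprn_gt0 ?q_gt0 ?ltr0n // /qR -!natrX ler_nat.
Qed.

Lemma logq_ge0 N : 0 <= logq F (N%:R : R).
Proof.
have lq : 0 < ln (qR R F) by rewrite ln_gt0 // q_gt1.
case: N => [|N]; first by rewrite /logq ln0 ?mul0r.
by apply: divr_ge0; [rewrite ln_ge0 ?ler1n | apply: ltW].
Qed.

(** Rounding [D] up admits more conductors and strengthens the bound, so natural [D] imply the real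
    ones. *)
Lemma siegel_walfiszP psi : siegel_walfisz psi <-> nat_siegel_walfisz psi.
Proof.
split=> [[D0 D00 h]|[D0 h]].
  exists (Num.bound D0) => D DD.
  have DD' : D0 <= D%:R by apply: le_trans (ltW (archi_boundP (ltW D00))) _; rewrite ler_nat.
  have [K hK] := h D%:R DD'; exists `|K|; split=> // N m d chi N0 sm cm np cd qd.
  have := hK N m d chi N0 sm cm np cd; rewrite logq_cond // => /(_ qd).
  rewrite -/(twisted_sum psi N chi) -natrM powR_mulrn ?ler0n // => hh.
  have Np : 0 < N%:R ^+ (3 * D) :> R by rewrite exprn_gt0 ?ltr0n.
  move: hh; rewrite mulrA ler_pdivlMr // => hh; apply: le_trans hh _.
  by rewrite ler_wpM2r ?ler_norm // exprn_ge0 // ltW // q_gt0.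
exists D0.+1%:R; first by rewrite ltr0n.
move=> D DD; pose D' := Num.bound D.
have D0' : 0 <= D by apply: le_trans DD; rewrite ler0n.
have D'D : D <= D'%:R by apply/ltW/archi_boundP.
have DD' : (D0 <= D')%N by rewrite -(ler_nat R) (le_trans _ (le_trans DD D'D)) // ler_nat.
have [K [K0 hK]] := h D' DD'; exists K => N m d chi N0 sm cm np cd dd.
have Np : 0 < N%:R ^+ (3 * D') :> R by rewrite exprn_gt0 ?ltr0n.
have := hK N m d chi N0 sm cm np cd; rewrite -(logq_cond _ _ N0).
have -> : (size d).-1%:R <= D'%:R * logq F (N%:R : R).
  by apply: le_trans dd _; rewrite ler_wpM2r // logq_ge0.
move=> /(_ isT); rewrite -ler_pdivlMr // => hh; apply: le_trans hh _.
rewrite -mulrA ler_wpM2l // ler_wpM2l ?exprn_ge0 ?(ltW q_gt0) //.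
rewrite lef_pV2 ?posrE ?powR_gt0 ?ltr0n // -powR_mulrn ?ler0n // natrM.
by apply: ler_powR; rewrite ?ler1n // ler_wpM2l.
Qed.

Lemma bv_cond (k N : nat) (B : nat) : (0 < N)%N ->
  (k%:R <= N%:R / 2 - B%:R * logq F (N%:R : R)) =
  (#|F| ^ (2 * k) * N ^ (2 * B) <= #|F| ^ N)%N.
Proof.
move=> N0; have lq : 0 < ln (qR R F) by rewrite ln_gt0 // q_gt1.
have Np : 0 < N%:R :> R by rewrite ltr0n.
rewrite -(ler_nat R) natrM !natrX -[RHS]ler_ln ?posrE ?mulr_gt0 ?exprn_gt0 ?q_gt0 //.
rewrite lnM ?posrE ?exprn_gt0 ?q_gt0 // !lnXn ?q_gt0 //.
rewrite /logq -/(qR R F); set a := ln (qR R F) in lq *; set b := ln (N%:R : R).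
have a0 : a != 0 by rewrite gt_eqF.
rewrite -subr_ge0 -[RHS]subr_ge0.
have -> : N%:R / 2 - B%:R * (b / a) - k%:R =
    (N%:R * a - (2 * k%:R * a + 2 * B%:R * b)) / (2 * a) by field.
rewrite pmulr_lge0 ?invr_gt0 ?mulr_gt0 //; congr (0 <= _).
by rewrite -(mulr_natl a (2 * k)) -(mulr_natl b (2 * B)) -(mulr_natl a N) !natrM; ring.
Qed.

Lemma bombieri_vinogradovP psi : bombieri_vinogradov psi <-> nat_bombieri_vinogradov psi.
Proof.
have bv0 N m : 0 <= bvE_max N m psi.
  by rewrite /bvE_max; elim/big_rec: _ => // i x _ x0; rewrite le_max x0 orbT.
split=> [h A|h A A0].
  (* The real form requires a positive exponent, hence [A.+1]. *)
  have [B B0 [K hK]] := h A.+1%:R (ltr0Sn _ _).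
  exists (Num.bound B), `|K|; split=> // N N0.
  have Np : 0 < N%:R ^+ A.+1 :> R by rewrite exprn_gt0 ?ltr0n.
  have {}hK := hK N N0; rewrite powR_mulrn ?ler0n // mulrA ler_pdivlMr // in hK.
  apply: le_trans (_ : `|K| * q ^+ N <= _) => //.
  apply: le_trans (_ : K * q ^+ N <= _); last first.
    by rewrite ler_wpM2r ?ler_norm // exprn_ge0 // ltW // q_gt0.
  apply: le_trans hK; apply: ler_pM.
  - by apply: sumr_ge0.
  - by rewrite exprn_ge0.
  - rewrite [leLHS]big_mkcond [leRHS]big_mkcond; apply: ler_sum => m _.
    rewrite /small_modulus; case: ifP => [/andP[mm]|_]; last by case: ifP.
    rewrite -bv_cond // => mB; rewrite mm /= ifT //; apply: le_trans mB _.
    by rewrite lerD2l lerN2 ler_wpM2r ?logq_ge0 // ltW // archi_boundP // ltW.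
  - by rewrite ler_weXn2l // ler1n.
have [B [K [K0 hK]]] := h (Num.bound A).
exists B.+1%:R; first by rewrite ltr0n.
exists K => N N0; have Np : 0 < N%:R ^+ Num.bound A :> R by rewrite exprn_gt0 ?ltr0n.
have {}hK := hK N N0; rewrite -ler_pdivlMr // in hK.
apply: le_trans (_ : K * q ^+ N / N%:R ^+ Num.bound A <= _); last first.
  rewrite -mulrA ler_wpM2l // ler_wpM2l ?exprn_ge0 ?(ltW q_gt0) //.
  rewrite lef_pV2 ?posrE ?powR_gt0 ?ltr0n // -powR_mulrn ?ler0n //.
  by apply: ler_powR; rewrite ?ler1n // ltW // archi_boundP // ltW.
apply: le_trans hK; rewrite [leLHS]big_mkcond [leRHS]big_mkcond; apply: ler_sum => m _.
rewrite /small_modulus; case: ifP => [/andP[mm mB]|_]; last by case: ifP.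
rewrite mm -bv_cond //= ifT //; apply: le_trans mB _.
by rewrite lerD2l lerN2 ler_wpM2r ?logq_ge0 // ler_nat.
Qed.

End Reformulation.

(** * Moments and the Siegel-Walfisz bound for convolutions *)

Section Convolution.
Local Open Scope ring_scope.
Variables (R : realType) (F : finFieldType).
Implicit Types (psi : arithfun R F) (N : nat).
Local Notation q := (qR R F).
Local Notation nc := (@Normc.normc R).

Lemma qX_ge0 k : 0 <= q ^+ k.
Proof. by rewrite exprn_ge0 // ltW // q_gt0. Qed.

Lemma ler_qX j k : (j <= k)%N -> q ^+ j <= q ^+ k.
Proof. by move=> jk; rewrite ler_weXn2l // ltW // q_gt1. Qed.

(** The loss is a power of the ambient [N], not of [a]: degree 0 is no exception, and bounds for two
    factors of degrees [a + b <= N] multiply directly. *)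
Definition moment_bound psi (K : R) (c : nat) := forall N a, (0 < N)%N -> (a <= N)%N ->
  \sum_(f : {poly_a.+1 F} | monic_deg a f) nc (psi f) <= K * q ^+ a * N%:R ^+ c /\
  \sum_(f : {poly_a.+1 F} | monic_deg a f) nc (psi f) ^+ 2 <= K * q ^+ a * N%:R ^+ c.

Lemma leq_expX (a b n : nat) : (a <= b)%N -> (a ^ n <= b ^ n)%N.
Proof. by case: n => // n ab; rewrite leq_exp2r. Qed.

Lemma moment_bound_le psi K K' c c' : K <= K' -> (c <= c')%N ->
  moment_bound psi K c -> moment_bound psi K' c'.
Proof.
move=> KK cc h N a N0 aN; have [h1 h2] := h N a N0 aN.
have e : K * q ^+ a * N%:R ^+ c <= K' * q ^+ a * N%:R ^+ c'.
  apply: le_trans (_ : K' * q ^+ a * N%:R ^+ c <= _).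
    by rewrite ler_wpM2r ?exprn_ge0 // ler_wpM2r // qX_ge0.
  case: (leP 0 K') => [K'0|K'0].
    by rewrite ler_wpM2l ?mulr_ge0 ?qX_ge0 // ler_weXn2l // ler1n.
  have : K * q ^+ a * N%:R ^+ c < 0.
    by rewrite nmulr_rlt0 ?exprn_gt0 ?ltr0n // nmulr_rlt0 ?(le_lt_trans KK) // exprn_gt0 // q_gt0.
  move/(le_lt_trans h1); rewrite ltNge sumr_ge0 // => f _; exact: normc_ge0.
by split; apply: le_trans e.
Qed.

Lemma nat_growth_moments psi : nat_growth psi -> exists (K : R) c, 0 <= K /\ moment_bound psi K c.
Proof.
move=> [c [K [K0 hK]]]; pose e := (2 ^ (2 * c)).-1.
(* [e] belongs to the moment of order [2 * c] of [tau], [2 ^+ e] comes from [a.+1 <= 2 * N], and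
   [K], [K ^+ 2] serve the first and the second moment of [psi]. *)
exists ((K + K ^+ 2) * 2 ^+ e), e; split; first by rewrite mulr_ge0 ?exprn_ge0 ?addr_ge0 ?exprn_ge0.
move=> N a N0 aN.
have t j : (j <= 2 * c)%N -> \sum_(f : {poly_a.+1 F} | monic_deg a f) (tau f)%:R ^+ j <=
    2 ^+ e * q ^+ a * N%:R ^+ e :> R.
  move=> jc; apply: le_trans (tau_moment F R j a) _.
  rewrite [2 ^+ e * _]mulrC -mulrA ler_wpM2l ?qX_ge0 // -exprMn -natrM.
  apply: (@le_trans _ _ ((2 * N)%:R ^+ (2 ^ j).-1)).
    apply: lerXn2r; rewrite ?nnegrE ?ler0n // ler_nat; lia.
  rewrite ler_weXn2l ?ler1n ?muln_gt0 //.
  have : (2 ^ j <= 2 ^ (2 * c))%N by rewrite leq_exp2l.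
  rewrite /e; lia.
pose Z : R := 2 ^+ e * q ^+ a * N%:R ^+ e.
have Z0 : 0 <= Z by rewrite !mulr_ge0 ?exprn_ge0 ?(ltW (q_gt0 R F)).
have -> : (K + K ^+ 2) * 2 ^+ e * q ^+ a * N%:R ^+ e = (K + K ^+ 2) * Z by rewrite /Z !mulrA.
split.
  apply: (@le_trans _ _ (K * Z)); last by rewrite ler_wpM2r // lerDl exprn_ge0.
  apply: le_trans (ler_wpM2l K0 (t c _)); last by rewrite mul2n -addnn leq_addr.
  by rewrite mulr_sumr; apply: ler_sum => f /monic_degP[fm _]; apply: hK.
apply: (@le_trans _ _ (K ^+ 2 * Z)); last by rewrite ler_wpM2r // lerDr.
apply: le_trans (ler_wpM2l (exprn_ge0 2 K0) (t (2 * c)%N (leqnn _))).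
rewrite mulr_sumr; apply: ler_sum => f /monic_degP[fm _].
rewrite mulnC exprM -exprMn; apply: lerXn2r; rewrite ?nnegrE ?normc_ge0 ?mulr_ge0 ?exprn_ge0 //.
exact: hK.
Qed.

(** There are [tau f] factorizations [f = g * h], and both [tau g] and [tau h] are at most [tau f];
    this gives the exponent [(c1 + c2).+1]. *)
Lemma nat_growth_dconv psi1 psi2 : nat_growth psi1 -> nat_growth psi2 ->
  nat_growth (dconv psi1 psi2).
Proof.
move=> [c1 [K1 [K10 h1]]] [c2 [K2 [K20 h2]]].
exists (c1 + c2).+1, (K1 * K2); split; first exact: mulr_ge0.
move=> f fm; rewrite exprS mulrCA [X in X * _](tauE _ fm) /divisor_sum mulr_suml.
apply: le_trans (normc_sum _ _ _) _; apply: ler_sum => g gm.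
rewrite mulr_suml; apply: le_trans (normc_sum _ _ _) _; apply: ler_sum => h /andP[hm /eqP gh].
rewrite mul1r Normc.normcM exprD mulrACA.
have tg : (tau g <= tau f)%N.
  by apply: tau_dvd => //; have := dvdp_mulr h (dvdpp (g : {poly F})); rewrite gh.
have th : (tau h <= tau f)%N.
  by apply: tau_dvd => //; have := dvdp_mull g (dvdpp (h : {poly F})); rewrite gh.
apply: ler_pM; rewrite ?normc_ge0 //.
  apply: le_trans (h1 g gm) _; rewrite ler_wpM2l //.
  by apply: lerXn2r; rewrite ?nnegrE ?ler0n // ler_nat.
apply: le_trans (h2 h hm) _; rewrite ler_wpM2l //.
by apply: lerXn2r; rewrite ?nnegrE ?ler0n // ler_nat.
Qed.

Lemma sum_dconv psi1 psi2 (w : {poly F} -> R[i]) M :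
  \sum_(f : {poly_M.+1 F} | monic_deg M f) dconv psi1 psi2 f * w f =
  \sum_(a < M.+1) \sum_(g : {poly_a.+1 F} | monic_deg a g)
    \sum_(h : {poly_(M - a).+1 F} | monic_deg (M - a) h) psi1 g * psi2 h * w ((g : {poly F}) * h).
Proof.
rewrite -(sum_divisor_sum (fun g h => psi1 g * psi2 h * w (g * h))).
apply: eq_bigr => f _; rewrite /dconv /divisor_sum mulr_suml; apply: eq_bigr => g _.
by rewrite mulr_suml; apply: eq_bigr => h /andP[_ /eqP gh]; rewrite gh.
Qed.

Lemma twisted_sum_dconv psi1 psi2 (w : {poly F} -> R[i]) M : {morph w : f g / f * g} ->
  twisted_sum (dconv psi1 psi2) M w =
  \sum_(a < M.+1) twisted_sum psi1 a w * twisted_sum psi2 (M - a) w.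
Proof.
move=> wM; rewrite /twisted_sum sum_dconv; apply: eq_bigr => a _.
rewrite mulr_suml; apply: eq_bigr => g _; rewrite mulr_sumr; apply: eq_bigr => h _.
by rewrite wM mulrACA.
Qed.

Lemma twisted_sum_le psi (w : {poly F} -> R[i]) a : (forall f, nc (w f) <= 1) ->
  nc (twisted_sum psi a w) <= \sum_(f : {poly_a.+1 F} | monic_deg a f) nc (psi f).
Proof.
move=> w1; apply: le_trans (normc_sum _ _ _) _; apply: ler_sum => f _.
by rewrite Normc.normcM ler_piMr ?normc_ge0.
Qed.

Lemma dirichlet_norm_le1 m (chi : {poly F} -> R[i]) : m != 0 -> dirichlet m chi ->
  forall f, nc (chi f) <= 1.
Proof.
move=> m0 D f; have [fm|fm] := boolP (coprimep f m); last first.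
  by case: D => _ _ _ ->; rewrite ?Normc.normc0.
have [X [XD X1 Xo _]] := dirichlet_family R[i] m0.
have [i Xi] := dirichlet_complete m0 XD X1 Xo D.
by rewrite -Xi normc_eq1 // X1.
Qed.

(** By multiplicativity of [chi] the twisted sum is a sum over [a] of products. One of [a], [N - a]
    is at least N / 2 and receives the Siegel-Walfisz bound; the other factor is bounded by its
    first moment. *)
Lemma nat_siegel_walfisz_dconv psi1 psi2 : nat_growth psi1 -> nat_growth psi2 ->
  nat_siegel_walfisz psi1 -> nat_siegel_walfisz psi2 ->
  nat_siegel_walfisz (dconv psi1 psi2).
Proof.
move=> g1 g2 [D1 h1] [D2 h2].
have [K3 [c3 [K30 m3]]] := nat_growth_moments (nat_growth_dconv g1 g2).
have [Ka [ca [Ka0 ma]]] := nat_growth_moments g1.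
have [Kb [cb [Kb0 mb]]] := nat_growth_moments g2.
(* In [D'] the factor 2 is the price of comparing [N] with [x ^ 2] for [x >= N / 2], [c] pays for
   the moment factor and the 1 for the number of values of [a]. *)
pose c := (ca + cb)%N; exists (D1 + D2)%N => D DD; pose D' := (2 * (D + c.+1))%N.
have [|K1 [K10 {}h1]] := h1 D'; first by rewrite /D'; lia.
have [|K2 [K20 {}h2]] := h2 D'; first by rewrite /D'; lia.
pose K4 : R := K3 * 4 ^+ c3 * 4 ^+ (3 * D).
have K40 : 0 <= K4 by rewrite !mulr_ge0 ?exprn_ge0.
exists (K4 + 2 * (K1 * Kb + Ka * K2)); split; first by rewrite addr_ge0 // !(mulr_ge0, addr_ge0).
move=> N m d chi N0 sm cm np cd qd.
have m0 : m != 0 by rewrite -size_poly_gt0 ltnW.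
have D0 := (character_modP _ m0).1 cm; have w1 := dirichlet_norm_le1 m0 D0.
(* For [N >= 4], [N <= 2 * x] implies [N <= x ^ 2]. The smaller [N] are absorbed into the constant
   [K4]. *)
case: (ltnP N 4) => N4.
  have [m31 _] := m3 N N N0 (leqnn _).
  apply: le_trans (_ : K4 * q ^+ N <= _); last first.
    by rewrite ler_wpM2r ?qX_ge0 // lerDl !(mulr_ge0, addr_ge0).
  have -> : K4 * q ^+ N = K3 * q ^+ N * 4 ^+ c3 * 4 ^+ (3 * D) by rewrite /K4; ring.
  have hX n : N%:R ^+ n <= 4 ^+ n :> R.
    by apply: lerXn2r; rewrite ?nnegrE ?ler0n // ler_nat ltnW.
  apply: ler_pM; rewrite ?normc_ge0 ?exprn_ge0 //.
  apply: le_trans (twisted_sum_le _ _ w1) _; apply: le_trans m31 _.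
  by rewrite ler_wpM2l // mulr_ge0 ?qX_ge0.
have gt0 x : (N <= 2 * x)%N -> (0 < x)%N by lia.
have half x : (2 * x < N)%N -> (N <= 2 * (N - x))%N by lia.
have Np : 0 < N%:R :> R by rewrite ltr0n.
have big x : (N <= 2 * x)%N -> (N%:R ^+ (3 * D + c.+1) <= x%:R ^+ (3 * D') :> R).
  move=> Nx; have xx : (N <= x ^ 2)%N by rewrite expnS expn1; nia.
  rewrite -!natrX ler_nat /D' mulnCA expnM.
  apply: (@leq_trans (N ^ (3 * (D + c.+1)))); first by rewrite leq_pexp2l //; lia.
  exact: leq_expX.
have qD x : (N <= 2 * x)%N -> (#|F| ^ (size d).-1 <= x ^ D')%N.
  move=> Nx; apply: leq_trans qd _; rewrite /D' expnM.
  apply: (@leq_trans ((x ^ 2) ^ D)).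
    by apply: leq_expX; rewrite expnS expn1; nia.
  by rewrite leq_pexp2l; [|rewrite expn_gt0; lia|lia].
have Dm : {morph chi : f g / f * g} by case: D0.
have aux (A B X Y Z : R) x : 0 <= X -> 0 <= Y -> 0 <= A -> 0 <= B -> (N <= 2 * x)%N ->
    X * x%:R ^+ (3 * D') <= A -> Y <= B * N%:R ^+ c -> X * Y * N%:R ^+ (3 * D).+1 <= A * B.
  move=> X0 Y0 A0 B0 Nx XA YB; rewrite -(ler_pM2r (exprn_gt0 c Np)).
  have -> : X * Y * N%:R ^+ (3 * D).+1 * N%:R ^+ c = (X * N%:R ^+ (3 * D + c.+1)) * Y.
    by rewrite addnS exprS exprS exprD; ring.
  rewrite -[leRHS]mulrA; apply: ler_pM => //; first by rewrite mulr_ge0 ?exprn_ge0 ?ler0n.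
  by apply: le_trans XA; rewrite ler_wpM2l // big.
have mc (e : nat) : (e <= c)%N -> N%:R ^+ e <= N%:R ^+ c :> R.
  by move=> ec; rewrite ler_weXn2l // ler1n.
have term (a : 'I_N.+1) : nc (twisted_sum psi1 a chi * twisted_sum psi2 (N - a) chi) *
    N%:R ^+ (3 * D).+1 <= (K1 * Kb + Ka * K2) * q ^+ N.
  have aN : (a <= N)%N by rewrite -ltnS.
  have qN : q ^+ N = q ^+ a * q ^+ (N - a) by rewrite -exprD subnKC.
  have Qa := qX_ge0 a; have Qb := qX_ge0 (N - a).
  have Z1 : 0 <= K1 * Kb * (q ^+ a * q ^+ (N - a)) by rewrite !mulr_ge0.
  have Z2 : 0 <= Ka * K2 * (q ^+ a * q ^+ (N - a)) by rewrite !mulr_ge0.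
  have [ma1 _] := ma N a N0 aN; have [mb1 _] := mb N (N - a)%N N0 (leq_subr _ _).
  rewrite Normc.normcM qN mulrDl; have [Na|Na] := leqP N (2 * a).
    apply: (@le_trans _ _ (K1 * Kb * (q ^+ a * q ^+ (N - a)))); last by rewrite lerDl.
    have -> : K1 * Kb * (q ^+ a * q ^+ (N - a)) = (K1 * q ^+ a) * (Kb * q ^+ (N - a)) by ring.
    apply: (aux _ _ _ _ 0 a); rewrite ?normc_ge0 ?mulr_ge0 //.
      have a0 := gt0 a Na.
      exact: (h1 a m d chi a0 sm cm np cd (qD a Na)).
    apply: le_trans (twisted_sum_le _ _ w1) _; apply: le_trans mb1 _.
    by rewrite ler_wpM2l ?mulr_ge0 // mc // leq_addl.
  apply: (@le_trans _ _ (Ka * K2 * (q ^+ a * q ^+ (N - a)))); last by rewrite lerDr.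
  have -> : Ka * K2 * (q ^+ a * q ^+ (N - a)) = (K2 * q ^+ (N - a)) * (Ka * q ^+ a) by ring.
  have Na' := half a Na.
  rewrite [nc _ * nc _]mulrC; apply: (aux _ _ _ _ 0 (N - a)%N); rewrite ?normc_ge0 ?mulr_ge0 //.
  - have a0 := gt0 _ Na'.
    exact: (h2 (N - a)%N m d chi a0 sm cm np cd (qD _ Na')).
  - apply: le_trans (twisted_sum_le _ _ w1) _; apply: le_trans ma1 _.
    by rewrite ler_wpM2l ?mulr_ge0 // mc // leq_addr.
rewrite twisted_sum_dconv // -(ler_pM2r Np) -mulrA -exprSr.
apply: (@le_trans _ _ (\sum_(a < N.+1) (K1 * Kb + Ka * K2) * q ^+ N)).
  apply: le_trans (ler_wpM2r _ (normc_sum _ _ _)) _; first by rewrite exprn_ge0.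
  by rewrite mulr_suml; apply: ler_sum => a _; apply: term.
rewrite sumr_const card_ord -[_ *+ N.+1]mulr_natl.
have KK0 : 0 <= (K1 * Kb + Ka * K2) * q ^+ N by rewrite mulr_ge0 ?qX_ge0 // addr_ge0 ?mulr_ge0.
apply: (@le_trans _ _ (2 * N%:R * ((K1 * Kb + Ka * K2) * q ^+ N))).
  by rewrite ler_wpM2r // -natrM ler_nat; lia.
have -> : 2 * N%:R * ((K1 * Kb + Ka * K2) * q ^+ N) = 2 * (K1 * Kb + Ka * K2) * q ^+ N * N%:R by ring.
by rewrite ler_pM2r // ler_wpM2r ?qX_ge0 // lerDr.
Qed.
End Convolution.

(** * Bilinear discrepancies *)

Section CharacterSums.
Local Open Scope ring_scope.
Variables (R : realType) (F : finFieldType).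
Implicit Types (psi : arithfun R F) (f g h m d e l : {poly F}).
Local Notation nc := (@Normc.normc R).

Fact dchar_subproof m : exists X : 'I_(phi m) -> arithfun R F, m != 0 ->
  [/\ forall i, dirichlet m (X i),
      forall i f, coprimep f m -> `|X i f| = 1,
      forall f g, coprimep f m -> coprimep g m ->
        \sum_i X i f * (X i g)^* = if f %% m == g %% m then (phi m)%:R else 0 &
      forall i j, X i =1 X j -> i = j].
Proof.
have [->|m0] := eqVneq m 0; first by exists (fun _ _ => 0).
by have [X] := dirichlet_family R[i] m0; exists X.
Qed.

(** One fixed list of the characters of each modulus, total in [m] (a zero function at [m = 0]), so
    that sums over characters are finite sums over an ordinal depending on [m]. *)
Definition dchar m : 'I_(phi m) -> arithfun R F := projT1 (cid (dchar_subproof m)).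

Lemma dcharP m : m != 0 ->
  [/\ forall i : 'I_(phi m), dirichlet m (dchar i),
      forall (i : 'I_(phi m)) f, coprimep f m -> `|dchar i f| = 1,
      forall f g, coprimep f m -> coprimep g m ->
        \sum_(i < phi m) dchar i f * (dchar i g)^* = if f %% m == g %% m then (phi m)%:R else 0 &
      forall i j : 'I_(phi m), dchar i =1 dchar j -> i = j].
Proof. exact: projT2 (cid (dchar_subproof m)). Qed.

Lemma dchar_complete m (chi : arithfun R F) : m != 0 -> dirichlet m chi ->
  exists i : 'I_(phi m), dchar i =1 chi.
Proof. by move=> m0; have [XD X1 Xo _] := dcharP m0; apply: dirichlet_complete. Qed.

Definition nonprincipal m (i : 'I_(phi m)) : bool := `[< ~ principal_mod m (dchar i) >].

Definition bilinear_discrepancy psi1 psi2 (a b : nat) m l : R[i] :=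
  (\sum_(g : {poly_a.+1 F} | monic_deg a g) \sum_(h : {poly_b.+1 F} | monic_deg b h)
     psi1 g * psi2 h * (((g : {poly F}) * h) %% m == l %% m)%:R) -
  (phi m)%:R^-1 *
  \sum_(g : {poly_a.+1 F} | monic_deg a g) \sum_(h : {poly_b.+1 F} | monic_deg b h)
     psi1 g * psi2 h * (coprimep ((g : {poly F}) * h) m)%:R.

Lemma sum_mkcond_mul M (Q : pred {poly F}) (u : {poly F} -> R[i]) :
  \sum_(f : {poly_M.+1 F} | monic_deg M f && Q f) u f =
  \sum_(f : {poly_M.+1 F} | monic_deg M f) u f * (Q f)%:R.
Proof.
by rewrite big_mkcondr; apply: eq_bigr => f _; case: (Q f); rewrite ?mulr1 ?mulr0.
Qed.

Lemma bvE_dconv psi1 psi2 M m l : bvE M m l (dconv psi1 psi2) =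
  \sum_(a < M.+1) bilinear_discrepancy psi1 psi2 a (M - a) m l.
Proof.
rewrite /bvE; have /= -> := sum_mkcond_mul M (fun f => f %% m == l %% m) (dconv psi1 psi2).
have /= -> := sum_mkcond_mul M (fun f => coprimep f m) (dconv psi1 psi2).
have /= -> := sum_dconv psi1 psi2 (fun f => (f %% m == l %% m)%:R) M.
have /= -> := sum_dconv psi1 psi2 (fun f => (coprimep f m)%:R) M.
by rewrite mulr_sumr -sumrB.
Qed.

Lemma bilinear_discrepancyC psi1 psi2 a b m l :
  bilinear_discrepancy psi1 psi2 a b m l = bilinear_discrepancy psi2 psi1 b a m l.
Proof.
rewrite /bilinear_discrepancy exchange_big [X in _ - _ * X]exchange_big /=.
by congr (_ - _ * _); apply: eq_bigr => h _; apply: eq_bigr => g _;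
  rewrite [psi1 g * _]mulrC [(g : {poly F}) * h]mulrC.
Qed.

(** The orthogonality relation with one term moved across: the subtracted mean is the contribution
    of the principal character. If [f] is not coprime to [m], both sides vanish. *)
Lemma nonprincipal_kernel m f l : m != 0 -> coprimep l m ->
  (f %% m == l %% m)%:R - (phi m)%:R^-1 * (coprimep f m)%:R =
  (phi m)%:R^-1 * \sum_(i < phi m | nonprincipal i) (dchar i l)^* * dchar i f :> R[i].
Proof.
move=> m0 lm; have [XD X1 Xo XI] := dcharP m0.
have p0 : (phi m)%:R != 0 :> R[i] by rewrite pnatr_eq0 -lt0n phi_gt0.
have [fm|fm] := boolP (coprimep f m); last first.
  rewrite big1 => [|i _]; last by have [_ _ _ X0] := XD i; rewrite (X0 f fm) mulr0.
  rewrite !mulr0 subr0; case: eqP => // e.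
  by rewrite (eq_modp_coprimep e) lm in fm.
pose chi0 f : R[i] := (coprimep f m)%:R.
have D0 : dirichlet m chi0.
  rewrite /chi0; split=> [|g h|g|g /negPf -> //]; first by rewrite coprime1p.
  - by rewrite coprimepMl -natrM mulnb.
  - by rewrite coprimep_modl.
have [i0 Xi0] := dchar_complete m0 D0.
have npE i : nonprincipal i = (i != i0).
  apply/asboolP/idP => [np|/eqP ne pr].
    by apply/eqP => e; apply: np => g gm; rewrite e Xi0 /chi0 gm.
  apply: ne; apply: XI => g; rewrite Xi0 /chi0.
  by have [gm|gm] := boolP (coprimep g m); [apply: pr | case: (XD i) => _ _ _ ->].
have := Xo f l fm lm; rewrite (bigD1 i0) //= !Xi0 /chi0 fm lm mul1r conjC1 => S.
rewrite mulr1 (eq_bigl _ _ npE) (eq_bigr (fun i => dchar i f * (dchar i l)^*)); last first.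
  by move=> i _; rewrite mulrC.
apply: (mulfI p0); rewrite mulrBr mulVKf // divff //.
move/(congr1 (fun x => x - 1)): S; rewrite addrAC subrr add0r => ->.
by case: eqP => _; rewrite ?mulr1 ?mulr0.
Qed.

Lemma bilinear_discrepancyE psi1 psi2 a b m l : m != 0 -> coprimep l m ->
  bilinear_discrepancy psi1 psi2 a b m l =
  (phi m)%:R^-1 * \sum_(i < phi m | nonprincipal i)
     (dchar i l)^* * (twisted_sum psi1 a (dchar i) * twisted_sum psi2 b (dchar i)).
Proof.
move=> m0 lm; have [XD _ _ _] := dcharP m0.
rewrite /bilinear_discrepancy mulr_sumr -sumrB.
transitivity (\sum_(g : {poly_a.+1 F} | monic_deg a g) \sum_(h : {poly_b.+1 F} | monic_deg b h)
   psi1 g * psi2 h * ((phi m)%:R^-1 * \sum_(i < phi m | nonprincipal i) (dchar i l)^* * dchar i ((g : {poly F}) * h))).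
  apply: eq_bigr => g _; rewrite mulr_sumr -sumrB; apply: eq_bigr => h _.
  by rewrite -(nonprincipal_kernel _ m0 lm) mulrBr; congr (_ - _); rewrite mulrCA.
rewrite mulr_sumr.
transitivity (\sum_(g : {poly_a.+1 F} | monic_deg a g) \sum_(h : {poly_b.+1 F} | monic_deg b h)
  \sum_(i < phi m | nonprincipal i) (phi m)%:R^-1 * ((dchar i l)^* *
     ((psi1 g * dchar i g) * (psi2 h * dchar i h)))).
  apply: eq_bigr => g _; apply: eq_bigr => h _; rewrite !mulr_sumr; apply: eq_bigr => i _.
  by have [_ -> _ _] := XD i; ring.
rewrite (eq_bigr (fun g : {poly_a.+1 F} => \sum_(i < phi m | nonprincipal i)
   \sum_(h : {poly_b.+1 F} | monic_deg b h) (phi m)%:R^-1 * ((dchar i l)^* *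
     ((psi1 g * dchar i g) * (psi2 h * dchar i h))))); last first.
  by move=> g _; rewrite exchange_big.
rewrite exchange_big; apply: eq_bigr => i _; rewrite /twisted_sum mulr_suml !mulr_sumr.
by apply: eq_bigr => g _; rewrite !mulr_sumr.
Qed.

Lemma bilinear_discrepancy_le psi1 psi2 a b m l : m != 0 -> coprimep l m ->
  nc (bilinear_discrepancy psi1 psi2 a b m l) <=
  (phi m)%:R^-1 * \sum_(i < phi m | nonprincipal i)
     nc (twisted_sum psi1 a (dchar i)) * nc (twisted_sum psi2 b (dchar i)).
Proof.
move=> m0 lm; have [_ X1 _ _] := dcharP m0.
rewrite bilinear_discrepancyE // Normc.normcM Normc.normcV normc_nat.
rewrite ler_wpM2l ?invr_ge0 //; apply: le_trans (normc_sum _ _ _) _.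
by apply: ler_sum => i _; rewrite !Normc.normcM normc_conj (normc_eq1 (X1 i l lm)) mul1r.
Qed.

Lemma bvE_le_max psi (b N : nat) m l : m != 0 -> (b <= N)%N -> coprimep l m ->
  nc (bvE b m l psi) <= bvE_max N m psi.
Proof.
move=> m0 bN lm; rewrite -bvE_mod -to_residueE //.
apply: le_trans (le_bigmax_cond _ (fun b : 'I_N.+1 => \big[Num.max/0]_(l : residue m | coprimep m l) nc (bvE b m l psi)) (isT : xpredT (Ordinal (bN : (b < N.+1)%N)))).
by apply: (le_bigmax_cond _ (fun l : residue m => nc (bvE b m l psi))); rewrite to_residueE // coprimep_sym coprimep_modl.
Qed.

Lemma bvE_max_ge0 psi N m : 0 <= bvE_max N m psi.
Proof. by rewrite /bvE_max; elim/big_rec: _ => // i x _ x0; rewrite le_max x0 orbT. Qed.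

(** For fixed [g] coprime to [m] with inverse [g'], the condition on [g * h] says that [h] lies in
    the class of [g' * l]: the inner sum is a discrepancy of [psi2] alone. Other [g] contribute
    0. *)
Lemma bilinear_discrepancy_le_bvE psi1 psi2 (a b N : nat) m l : m != 0 -> (b <= N)%N -> coprimep l m ->
  nc (bilinear_discrepancy psi1 psi2 a b m l) <=
  (\sum_(g : {poly_a.+1 F} | monic_deg a g) nc (psi1 g)) * bvE_max N m psi2.
Proof.
move=> m0 bN lm; rewrite /bilinear_discrepancy mulr_sumr -sumrB mulr_suml.
apply: le_trans (normc_sum _ _ _) _; apply: ler_sum => g _.
have [gm|gm] := boolP (coprimep (g : {poly F}) m); last first.
  rewrite !big1 ?mulr0 ?subr0 ?Normc.normc0 => [|h _|h _].
  - by rewrite mulr_ge0 ?normc_ge0 ?bvE_max_ge0.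
  - by rewrite coprimepMl (negPf gm) mulr0.
  - case: eqP => [e|]; rewrite ?mulr0 //.
    by move: lm; rewrite -(eq_modp_coprimep e) coprimepMl (negPf gm).
have [g' g'm gg] := coprimep_inverse m0 gm.
have -> : \sum_(h : {poly_b.+1 F} | monic_deg b h) psi1 g * psi2 h * (((g : {poly F}) * h) %% m == l %% m)%:R -
    (phi m)%:R^-1 * \sum_(h : {poly_b.+1 F} | monic_deg b h) psi1 g * psi2 h * (coprimep ((g : {poly F}) * h) m)%:R
    = psi1 g * bvE b m (g' * l) psi2.
  rewrite /bvE; have /= -> := sum_mkcond_mul b (fun f => f %% m == (g' * l) %% m) psi2.
  have /= -> := sum_mkcond_mul b (fun f => coprimep f m) psi2.
  rewrite mulrBr mulrCA !mulr_sumr; congr (_ - _); apply: eq_bigr => h _.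
    rewrite -mulrA; congr (_ * (_ * _%:R)); apply/esym; congr nat_of_bool.
    rewrite -[in RHS](modpM m g).
    apply/eqP/eqP => e.
      by rewrite modpM (eq_modpM erefl e) mulrA (eq_modpM gg erefl) mul1r.
    rewrite -[in LHS](mul1r (h : {poly F})) -(eq_modpM gg erefl) [_ * g']mulrC -mulrA.
    by apply: eq_modpM => //; rewrite -e modpM.
  by rewrite coprimepMl gm /= !mulrA.
by rewrite Normc.normcM ler_wpM2l ?normc_ge0 // bvE_le_max // coprimepMl g'm lm.
Qed.

Definition bilinear_max psi1 psi2 (a b : nat) m : R :=
  \big[Num.max/0]_(l : residue m | coprimep m l) nc (bilinear_discrepancy psi1 psi2 a b m l).

Lemma bilinear_max_le psi1 psi2 a b m (Z : R) : m != 0 -> 0 <= Z ->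
  (forall l, coprimep l m -> nc (bilinear_discrepancy psi1 psi2 a b m l) <= Z) ->
  bilinear_max psi1 psi2 a b m <= Z.
Proof. by move=> m0 Z0 h; apply: bigmax_le => // l lm; apply: h; rewrite coprimep_sym. Qed.

Lemma bilinear_max_ge0 psi1 psi2 a b m : 0 <= bilinear_max psi1 psi2 a b m.
Proof. by rewrite /bilinear_max; elim/big_rec: _ => // i x _ x0; rewrite le_max x0 orbT. Qed.

(** The maximum over [M] is replaced by a sum, at the cost of a factor [N.+1] only. *)
Lemma bvE_max_dconv psi1 psi2 N m :
  bvE_max N m (dconv psi1 psi2) <=
  \sum_(M < N.+1) \sum_(a < M.+1) bilinear_max psi1 psi2 a (M - a) m.
Proof.
have S0 (M : 'I_N.+1) : 0 <= \sum_(a < M.+1) bilinear_max psi1 psi2 a (M - a) m.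
  by apply: sumr_ge0 => a _; apply: bilinear_max_ge0.
apply: bigmax_le; first by apply: sumr_ge0 => M _; apply: S0.
move=> M _; rewrite (bigD1 M) //=; apply: le_trans (_ : \sum_(a < M.+1) bilinear_max psi1 psi2 a (M - a) m <= _).
  apply: bigmax_le => // l lm; rewrite bvE_dconv; apply: le_trans (normc_sum _ _ _) _.
  apply: ler_sum => a _.
  exact: (le_bigmax_cond _ (fun l : residue m => nc (bilinear_discrepancy psi1 psi2 a (M - a) m l))).
by rewrite lerDl; apply: sumr_ge0 => M' _; apply: S0.
Qed.

Lemma nonprincipal_conductor m (i : 'I_(phi m)) : m \is monic -> nonprincipal i ->
  exists d (j : 'I_(phi d)), [/\ is_conductor m (dchar i) d, (1 < size d)%N, 
     primitive d (dchar j) & forall f, coprimep f m -> dchar i f = dchar j f].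
Proof.
move=> mm /asboolP np; have m0 := monic_neq0 mm; have [XD _ _ _] := dcharP m0.
pose P n := `[< exists2 d, [/\ d \is monic, d %| m & induced_from m (dchar i) d] & size d = n >].
have exP : exists n, P n.
  exists (size m); apply/asboolP; exists m => //; split=> //.
  by exists (dchar i) => //; apply/character_modP.
have [n /asboolP[d [dm dvd [chi D e]] sd] nmin] := ex_minnP exP.
have d0 := monic_neq0 dm.
have min d' : d' \is monic -> d' %| m -> induced_from m (dchar i) d' -> (size d <= size d')%N.
  by move=> d'm d'd ind; rewrite sd; apply: nmin; apply/asboolP; exists d'.
have {}D := (character_modP chi d0).1 D.
have [j Xj] := dchar_complete d0 D.
exists d, j; split.
- split=> //; exists chi => //; exact/character_modP.
(* Modulo a constant all polynomials are congruent to 1, so a conductor of degree 0 would make the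
   character principal. *)
- rewrite ltnNge; apply/negP => d1; apply: np => f fm.
  have /size_poly1P[c c0 dE] : size d == 1 by rewrite eqn_leq d1 size_poly_gt0.
  rewrite e // -(dirichlet_modE D (_ : 1 %% d = f %% d)); first by case: D.
  by rewrite dE !modpC.
- move=> d' chi' d'm d'd D' e'; apply: min => //; first exact: dvdp_trans dvd.
  exists chi'; first by apply/character_modP => //; apply: monic_neq0.
  by move=> f fm; rewrite e // -Xj e' //; apply: coprimep_dvdl fm.
- by move=> f fm; rewrite e // Xj.
Qed.

End CharacterSums.

(** * Reduction to primitive characters *)

Section RealSums.
Local Open Scope ring_scope.
Variable R : realFieldType.

(** Each [i] picks one related [j], distinct [i] pick distinct [j], and the terms left over are
    nonnegative. It reindexes sums whose new index is known only through an existence statement. *)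
Lemma ler_sum_cover (I J : finType) (P : pred I) (Q : pred J) (rel : I -> J -> Prop)
    (u : I -> R) (v : J -> R) :
  (forall j, Q j -> 0 <= v j) ->
  (forall i, P i -> exists2 j, Q j & rel i j) ->
  (forall i i' j, P i -> P i' -> rel i j -> rel i' j -> i = i') ->
  (forall i j, P i -> Q j -> rel i j -> u i <= v j) ->
  \sum_(i | P i) u i <= \sum_(j | Q j) v j.
Proof.
move=> v0 ex inj uv.
pose h i := [pick j | Q j && `[< rel i j >]].
have hP i : P i -> exists j, [/\ h i = Some j, Q j & rel i j].
  move=> Pi; rewrite /h; case: pickP => [j /andP[Qj /asboolP r]|none]; first by exists j.
  by have [j Qj r] := ex i Pi; have := none j; rewrite Qj; move/asboolP: r => ->.
apply: (@le_trans _ _ (\sum_(i | P i) \sum_(j | Q j && (h i == Some j)) v j)).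
  apply: ler_sum => i Pi; have [j [hj Qj r]] := hP i Pi.
  rewrite (big_pred1 j) ?uv // => j'; rewrite hj /=.
  by apply/andP/eqP => [[_ /eqP[->]]|->].
rewrite (exchange_big_dep Q) /=; last by move=> i j _ /andP[].
apply: ler_sum => j Qj; rewrite Qj /=.
have [i /andP[Pi /eqP hi]|none] := pickP [pred i | P i && (h i == Some j)]; last first.
  by rewrite big_pred0 ?v0.
rewrite (big_pred1 i) // => i' /=.
apply/andP/eqP => [[Pi' /eqP hi']|->]; last by rewrite Pi hi.
have [j1 [e1 _ r1]] := hP i Pi; have [j2 [e2 _ r2]] := hP i' Pi'.
have j1E : j = j1 by move: e1; rewrite hi => -[].
have j2E : j = j2 by move: e2; rewrite hi' => -[].
by rewrite -j1E in r1; rewrite -j2E in r2; apply: inj r2 r1.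
Qed.

(** Lagrange's identity: the weighted sum of the squares of [x i * y j - x j * y i] is twice the
    difference of the two sides. *)
Lemma weighted_cauchy_schwarz (I : finType) (P : pred I) (w x y : I -> R) :
  (forall i, P i -> 0 <= w i) ->
  (\sum_(i | P i) w i * (x i * y i)) ^+ 2 <=
    (\sum_(i | P i) w i * x i ^+ 2) * (\sum_(i | P i) w i * y i ^+ 2).
Proof.
move=> w0; set X := \sum_(i | P i) _ * x i ^+ 2; set Y := \sum_(i | P i) _ * y i ^+ 2.
set Z := \sum_(i | P i) _ * (_ * _).
have : 0 <= \sum_(i | P i) \sum_(j | P j) w i * w j * (x i * y j - x j * y i) ^+ 2.
  apply: sumr_ge0 => i Pi; apply: sumr_ge0 => j Pj.
  by apply: mulr_ge0; [rewrite mulr_ge0 ?w0 | apply: sqr_ge0].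
have -> : \sum_(i | P i) \sum_(j | P j) w i * w j * (x i * y j - x j * y i) ^+ 2 =
    X * Y + Y * X - 2 * (Z * Z).
  rewrite /X /Y /Z !big_distrlr /= mulr_sumr -big_split -sumrB; apply: eq_bigr => i _ /=.
  by rewrite mulr_sumr -big_split -sumrB; apply: eq_bigr => j _ /=; ring.
have -> : X * Y + Y * X - 2 * (Z * Z) = 2 * (X * Y - Z ^+ 2) by ring.
by rewrite pmulr_rge0 // subr_ge0.
Qed.

End RealSums.

(** The arithmetic of the squared sieve bound, whose lengths are max(a + 1, 2k) and max(b + 1, 2k).
    When 2k is short for both, the factor q^(-2k) saves; when it exceeds one length only, the degree
    of that factor saves; when it exceeds both, the exponent is 2k + a + b and the restriction on
    the moduli saves. *)
Lemma sieve_exponents (q N D B a b k : nat) : 1 < q -> D <= B -> a + b <= N ->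
  N ^ D <= q ^ k -> N ^ (2 * D) <= q ^ a -> N ^ (2 * D) <= q ^ b ->
  q ^ (2 * k) * N ^ (2 * B) <= q ^ N -> 0 < N ->
  q ^ ((maxn a.+1 (2 * k) - k) + (maxn b.+1 (2 * k) - k) + (a + b)) * N ^ (2 * D) <= q ^ (2 * N.+1).
Proof.
move=> q1 DB abN hk ha hb hB N0.
have le e x y : N ^ (2 * D) <= q ^ x -> e + x <= y -> q ^ e * N ^ (2 * D) <= q ^ y.
  move=> h1 h2; apply: leq_trans (leq_mul (leqnn _) h1) _.
  by rewrite -expnD leq_exp2l.
have hk2 : N ^ (2 * D) <= q ^ (2 * k).
  by rewrite mulnC expnM (mulnC 2 k) expnM leq_exp2r.
case: (leqP (2 * k) a.+1) => ka; case: (leqP (2 * k) b.+1) => kb.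
- by apply: (le _ _ _ hk2); clear -abN ka kb; lia.
- by apply: (le _ _ _ hb); clear -abN ka kb; lia.
- by apply: (le _ _ _ ha); clear -abN ka kb; lia.
have -> : 2 * k - k + (2 * k - k) + (a + b) = 2 * k + (a + b) by clear; lia.
rewrite expnD mulnAC; apply: leq_trans (_ : q ^ N * q ^ (a + b) <= _).
  rewrite leq_mul2r; apply/orP; right; apply: leq_trans hB; by rewrite leq_mul2l leq_pexp2l ?leq_mul2l ?DB ?orbT.
by rewrite -expnD leq_exp2l //; clear -abN; lia.
Qed.

Section PrimitiveSums.
Local Open Scope ring_scope.
Variables (R : realType) (F : finFieldType).
Implicit Types (psi : arithfun R F) (f g h m d e l : {poly F}).
Local Notation nc := (@Normc.normc R).
Local Notation q := (qR R F).

Definition coprime_twist psi N e (chi : arithfun R F) : R[i] :=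
  twisted_sum psi N (fun f => (coprimep f e)%:R * chi f).

Definition induces m d (j : 'I_(phi d)) (i : 'I_(phi m)) : Prop :=
  [/\ nonprincipal R i, is_conductor m (dchar R i) d, (1 < size d)%N, primitive d (dchar R j) &
      forall f, coprimep f m -> dchar R i f = dchar R j f].

Definition inducing m d (j : 'I_(phi d)) : bool := `[< exists i : 'I_(phi m), induces j i >].

Lemma induces_twist psi N m d (j : 'I_(phi d)) (i : 'I_(phi m)) : m != 0 -> induces j i ->
  twisted_sum psi N (dchar R i) = coprime_twist psi N m (dchar R j).
Proof.
move=> m0 [_ _ _ _ e]; have [XD _ _ _] := dcharP R m0.
apply: eq_bigr => f _; have [fm|fm] := boolP (coprimep (f : {poly F}) m).
  by rewrite mul1r e.
by have [_ _ _ ->] := XD i; rewrite // mul0r.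
Qed.

(** A character modulo [m] is determined by the primitive character inducing it, so the map to pairs
    of a conductor and a primitive character is injective. *)
Lemma nonprincipal_sum_le psi1 psi2 a b N m : m \is monic -> (size m <= N.+1)%N ->
  \sum_(i < phi m | nonprincipal R i)
     nc (twisted_sum psi1 a (dchar R i)) * nc (twisted_sum psi2 b (dchar R i)) <=
  \sum_(d : {poly_N.+1 F}) \sum_(j < phi d | inducing m j)
     nc (coprime_twist psi1 a m (dchar R j)) * nc (coprime_twist psi2 b m (dchar R j)).
Proof.
move=> mm mN; have m0 := monic_neq0 mm; have [XD _ _ XI] := dcharP R m0.
rewrite (sig_big_dep _ _ (fun (d : {poly_N.+1 F}) (j : 'I_(phi d)) => nc (coprime_twist psi1 a m (dchar R j)) * nc (coprime_twist psi2 b m (dchar R j)))) /=.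
apply: (@ler_sum_cover _ _ _ _ _ (fun (i : 'I_(phi m)) (p : {d : {poly_N.+1 F} & 'I_(phi d)}) => induces (tagged p) i)).
- by move=> p _; rewrite mulr_ge0 ?normc_ge0.
- move=> i np; have [d [j [cd sd pj e]]] := nonprincipal_conductor mm np.
  have dN : (size d <= N.+1)%N.
    by case: cd => _ dm _ _; apply: leq_trans mN; rewrite dvdp_leq.
  have [dd dE] : exists dd : {poly_N.+1 F}, (dd : {poly F}) = d.
    by exists (npolyp N.+1 d); rewrite npolypK.
  subst d; exists (existT _ dd j); last by split.
  by apply/asboolP; exists i; split.
- move=> i i' p _ _ [_ _ _ _ e] [_ _ _ _ e']; apply: XI => f.
  have [fm|fm] := boolP (coprimep f m); first by rewrite e ?e'.
  by have [_ _ _ X0] := XD i; have [_ _ _ X0'] := XD i'; rewrite X0 ?X0'.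
- by move=> i p _ _ ind; rewrite -!(induces_twist _ _ m0 ind).
Qed.

Lemma small_modulus_dvd N B d m : (0 < N)%N -> d \is monic -> d %| m ->
  small_modulus N B m -> small_modulus N B d.
Proof.
move=> N0 dm dvd /andP[mm mB]; rewrite /small_modulus dm /=; apply: leq_trans mB.
rewrite leq_mul2r; apply/orP; right; rewrite leq_exp2l ?card_finNzRing_gt1 // leq_mul2l /=.
have := dvdp_leq (monic_neq0 mm) dvd; clear; case: (size d) => // s; case: (size m) => //.
Qed.

Lemma inducing_dvd m d (j : 'I_(phi d)) : inducing m j ->
  [/\ d \is monic, d %| m, (1 < size d)%N & primitive d (dchar R j)].
Proof. by move=> /asboolP[i [_ [dm dvd _ _] sd pj _]]. Qed.

(** Each [m] is written as [d * e] with [d] the conductor, and [phiM_ge] splits the weight. The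
    conductor inherits the bound on moduli by [small_modulus_dvd], while [e] is let free over all
    monic polynomials of degree at most [N], the terms being nonnegative. *)
Lemma modulus_sum_le (N B : nat) (U : {poly F} -> forall d, 'I_(phi d) -> R) : (0 < N)%N ->
  (forall m d j, 0 <= U m d j) ->
  \sum_(m : {poly_N.+1 F} | small_modulus N B m) (phi m)%:R^-1 *
    \sum_(d : {poly_N.+1 F}) \sum_(j < phi d | inducing m j) U m d j <=
  \sum_(e : {poly_N.+1 F} | (e : {poly F}) \is monic) (phi e)%:R^-1 *
    \sum_(d : {poly_N.+1 F} | small_modulus N B d) (phi d)%:R^-1 *
      \sum_(j < phi d | inducing ((d : {poly F}) * e) j) U ((d : {poly F}) * e) d j.
Proof.
move=> N0 U0; under eq_bigr do rewrite mulr_sumr.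
under [leRHS]eq_bigr do rewrite mulr_sumr.
rewrite exchange_big [leRHS]exchange_big /= [leRHS]big_mkcond /=.
apply: ler_sum => d _.
pose S m := \sum_(j < phi d | inducing m j) U m d j.
have S0 m : 0 <= S m by apply: sumr_ge0.
have Sn m : ~~ (((d : {poly F}) \is monic) && (d %| m)) -> S m = 0.
  move=> nd; rewrite /S big_pred0 // => j; apply: contraNF nd.
  by case/inducing_dvd => -> ->.
have [sd|sd] := boolP (small_modulus N B d); last first.
  rewrite big1 // => m sm; rewrite -/(S m) Sn ?mulr0 //.
  by apply: contra sd => /andP[dm dvd]; apply: small_modulus_dvd sm.
have dm : (d : {poly F}) \is monic by case/andP: sd.
have d0 := monic_neq0 dm.
rewrite (bigID (fun m : {poly_N.+1 F} => (d : {poly F}) %| m)) /= [X in _ + X]big1 ?addr0; last first.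
  by move=> m /andP[_ nd]; rewrite -/(S m) Sn ?mulr0 // dm.
apply: (@ler_sum_cover _ _ _ _ _ (fun m e : {poly_N.+1 F} => (m : {poly F}) = (d : {poly F}) * e)).
- move=> e _; do 2![apply: mulr_ge0; first by rewrite invr_ge0 ler0n].
  exact: S0.
- move=> m /andP[/andP[mm _] dvd].
  have mE : (d : {poly F}) * (m %/ d) = m by rewrite mulrC divpK.
  have sz : (size ((m : {poly F}) %/ d)%R <= N.+1)%N.
    by apply: leq_trans (leq_divp _ _) (size_npoly m).
  exists (npolyp N.+1 (m %/ d)); rewrite npolypK //.
  by rewrite -(monicMl _ dm) mE.
- by move=> m m' e _ _ e1 e2; apply: npoly_inj; rewrite e1 e2.
- move=> m e _ em ->; rewrite -/(S _) mulrA ler_wpM2r //.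
  have e0 := monic_neq0 em.
  rewrite -invfM -natrM lef_pV2 ?posrE ?ltr0n ?muln_gt0 ?phi_gt0 ?mulf_neq0 //.
  by rewrite ler_nat mulnC phiM_ge.
Qed.

End PrimitiveSums.

(** * Sums over conductors of a given degree *)

Section DegreeSums.
Local Open Scope ring_scope.
Variables (R : realType) (F : finFieldType).
Implicit Types (psi : arithfun R F) (f g h m d e l : {poly F}).
Local Notation nc := (@Normc.normc R).
Local Notation q := (qR R F).

(** The character already vanishes off the polynomials coprime to [d]. The remaining condition does
    not involve [d], so for fixed [e] one coefficient sequence serves all conductors in the
    sieve. *)
Lemma coprime_twistM psi N d e (j : 'I_(phi d)) : d != 0 ->
  coprime_twist psi N (d * e) (dchar R j) = coprime_twist psi N e (dchar R j).
Proof.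
move=> d0; have [XD _ _ _] := dcharP R d0; apply: eq_bigr => f _; rewrite coprimepMr.
have [fd //|fd] := boolP (coprimep (f : {poly F}) d).
by have [_ _ _ X0] := XD j; rewrite X0 // !mulr0.
Qed.

Lemma large_sieve_twist psi (n k a L : nat) e
    (P : pred {d : {poly_n F} & 'I_(phi d)}) :
  (2 * k <= L)%N -> (a < L)%N ->
  (forall p, P p -> [/\ (tag p : {poly F}) \is monic, size (tag p) = k.+1 & primitive (tag p) (dchar R (tagged p))]) ->
  \sum_(p | P p) (phi (tag p))%:R^-1 * nc (coprime_twist psi a e (dchar R (tagged p))) ^+ 2
   <= q ^+ (L - k) * \sum_(f : {poly_a.+1 F} | monic_deg a f) nc (psi f) ^+ 2.
Proof.
move=> kL aL PP.
(* The coefficients are extended by zero to all degrees < [L], since orthogonality may need [L]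
   larger than [a.+1]. *)
pose A f : R[i] := if monic_deg a f then psi f * (coprimep f e)%:R else 0.
have sum_A (u : {poly F} -> R[i]) : \sum_(f : {poly_L F}) A f * u f =
    \sum_(f : {poly_a.+1 F} | monic_deg a f) psi f * (coprimep f e)%:R * u f.
  rewrite (@sum_npoly_widen _ _ a.+1 L (monic_deg a) (fun f => psi f * (coprimep f e)%:R * u f)) //.
    rewrite [RHS]big_mkcond; apply: eq_bigr => f _; rewrite /A.
    by case: ifP; rewrite ?mul0r.
  by move=> f /monic_degP[_ ->].
have sum_A2 : \sum_(f : {poly_L F}) nc (A f) ^+ 2 <=
    \sum_(f : {poly_a.+1 F} | monic_deg a f) nc (psi f) ^+ 2.
  rewrite (@sum_npoly_widen _ _ a.+1 L (monic_deg a) (fun f => nc (psi f) ^+ 2)) //; last first.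
    by move=> f /monic_degP[_ ->].
  rewrite [leRHS]big_mkcond; apply: ler_sum => f _; rewrite /A.
  case: ifP => _; last by rewrite Normc.normc0 expr0n.
  case: (coprimep _ _); first by rewrite mulr1.
  by rewrite mulr0 Normc.normc0 expr0n exprn_ge0 // normc_ge0.
apply: le_trans (ler_wpM2l (qX_ge0 R F _) sum_A2).
have nA (z : R[i]) : `|z| ^+ 2 = (nc z ^+ 2)%:C%C by rewrite normcE rmorphXn.
have dP p : P p -> [/\ (tag p : {poly F}) \is monic, size (tag p) = k.+1,
    dirichlet (tag p) (dchar R (tagged p)) & primitive (tag p) (dchar R (tagged p))].
  by move=> /PP[dm ds dp]; split=> //; have [XD _ _ _] := dcharP R (monic_neq0 dm).
have n1 p : P p -> forall f, coprimep f (tag p) -> `|dchar R (tagged p) f| = 1.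
  by move=> /PP[dm _ _] f; have [_ X1 _ _] := dcharP R (monic_neq0 dm); apply: X1.
have inj p p' : P p -> P p' -> tag p = tag p' :> {poly F} ->
    dchar R (tagged p) =1 dchar R (tagged p') -> p = p'.
  case: p p' => [d j] [d' j'] /PP[/= dm _ _] _ /= /npoly_inj dd; subst d' => e'.
  by have [_ _ _ XI] := dcharP R (monic_neq0 dm); rewrite (XI _ _ e').
have := large_sieve A kL dP n1 inj.
have -> : \sum_(p | P p) `|\sum_(f : {poly_L F}) A f * dchar R (tagged p) f| ^+ 2 / (phi (tag p))%:R =
    (\sum_(p | P p) (phi (tag p))%:R^-1 * nc (coprime_twist psi a e (dchar R (tagged p))) ^+ 2)%:C%C.
  rewrite rmorph_sum; apply: eq_bigr => p _; rewrite sum_A nA [RHS]rmorphM /= fmorphV rmorph_nat mulrC.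
  congr (_ * (nc _ ^+ 2)%:C%C); apply: eq_bigr => f _.
  by rewrite mulrA.
have -> : (#|F| ^ (L - k))%:R * \sum_(f : {poly_L F}) `|A f| ^+ 2 =
    (q ^+ (L - k) * \sum_(f : {poly_L F}) nc (A f) ^+ 2)%:C%C.
  rewrite [RHS]rmorphM /= /qR -natrX [in RHS]rmorph_nat; congr (_ * _).
  by rewrite rmorph_sum; apply: eq_bigr => f _; rewrite nA.
by rewrite lecR.
Qed.

Definition degree_sum psi1 psi2 a b (N B k : nat) e : R :=
  \sum_(d : {poly_N.+1 F} | small_modulus N B d && (size d == k.+1)) (phi d)%:R^-1 *
    \sum_(j < phi d | inducing R ((d : {poly F}) * e) j)
      nc (coprime_twist psi1 a ((d : {poly F}) * e) (dchar R j)) *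
      nc (coprime_twist psi2 b ((d : {poly F}) * e) (dchar R j)).

Lemma degree_sum_ge0 psi1 psi2 a b N B k e : 0 <= degree_sum psi1 psi2 a b N B k e.
Proof.
apply: sumr_ge0 => d _; rewrite mulr_ge0 ?invr_ge0 ?ler0n // sumr_ge0 // => j _.
by rewrite mulr_ge0 ?normc_ge0.
Qed.

(** Cauchy-Schwarz with weight 1 / phi(d) over the primitive characters, and the large sieve on each
    factor with its own length; [sieve_exponents] then compares the squares of the two sides. *)
Lemma degree_sum_large psi1 psi2 (K : R) (c D B N a b k : nat) e :
  0 <= K -> moment_bound psi1 K c -> moment_bound psi2 K c -> (0 < N)%N ->
  (D <= B)%N -> (a + b <= N)%N -> (N ^ D <= #|F| ^ k)%N ->
  (N ^ (2 * D) <= #|F| ^ a)%N -> (N ^ (2 * D) <= #|F| ^ b)%N ->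
  degree_sum psi1 psi2 a b N B k e * N%:R ^+ D <= K * N%:R ^+ c * q ^+ N.+1.
Proof.
move=> K0 m1 m2 N0 DB abN hk ha hb.
have rhs0 : 0 <= K * N%:R ^+ c * q ^+ N.+1 by rewrite !mulr_ge0 ?qX_ge0 ?exprn_ge0.
(* If [k] violates the restriction on moduli, no conductor of degree [k] occurs and the sum is
   empty. *)
have [hB|hB] := leqP (#|F| ^ (2 * k) * N ^ (2 * B)) (#|F| ^ N); last first.
  rewrite /degree_sum big_pred0 ?mul0r // => d; apply/negP => /andP[/andP[_ dB] /eqP ds].
  by move: hB; rewrite ltnNge; move: dB; rewrite ds => ->.
(* The least lengths holding the degree of the variable and the 2k needed for orthogonality. *)
pose L1 := maxn a.+1 (2 * k); pose L2 := maxn b.+1 (2 * k).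
pose Q := fun p : {d : {poly_N.+1 F} & 'I_(phi d)} =>
  (small_modulus N B (tag p) && (size (tag p) == k.+1)) && inducing R ((tag p : {poly F}) * e) (tagged p).
have QP p : Q p -> [/\ (tag p : {poly F}) \is monic, size (tag p) = k.+1 & primitive (tag p) (dchar R (tagged p))].
  by move=> /andP[/andP[_ /eqP ds] /inducing_dvd[dm _ _ dp]].
have -> : degree_sum psi1 psi2 a b N B k e = \sum_(p | Q p) (phi (tag p))%:R^-1 *
    (nc (coprime_twist psi1 a e (dchar R (tagged p))) * nc (coprime_twist psi2 b e (dchar R (tagged p)))).
  rewrite /degree_sum; under eq_bigr do rewrite mulr_sumr.
  rewrite (sig_big_dep _ _ (fun (d : {poly_N.+1 F}) (j : 'I_(phi d)) => (phi d)%:R^-1 * (nc (coprime_twist psi1 a ((d : {poly F}) * e) (dchar R j)) * nc (coprime_twist psi2 b ((d : {poly F}) * e) (dchar R j))))) /=.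
  by apply: eq_bigr => p /QP[dm _ _]; rewrite !coprime_twistM ?monic_neq0.
set Z := \sum_(p | Q p) _.
have Z0 : 0 <= Z by apply: sumr_ge0 => p _; rewrite !mulr_ge0 ?invr_ge0 ?normc_ge0.
rewrite -(@ler_pXn2r _ 2) ?nnegrE ?mulr_ge0 ?exprn_ge0 //.
have V (psi : arithfun R F) x L : moment_bound psi K c -> (x <= N)%N -> (2 * k <= L)%N -> (x < L)%N ->
    \sum_(p | Q p) (phi (tag p))%:R^-1 * nc (coprime_twist psi x e (dchar R (tagged p))) ^+ 2 <=
    q ^+ (L - k) * (K * q ^+ x * N%:R ^+ c).
  move=> mb xN kL xL; apply: le_trans (large_sieve_twist psi e kL xL QP) _.
  by rewrite ler_wpM2l ?qX_ge0 //; case: (mb N x N0 xN).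
have aN : (a <= N)%N := leq_trans (leq_addr _ _) abN.
have bN : (b <= N)%N := leq_trans (leq_addl _ _) abN.
have V1 := V psi1 a L1 m1 aN (leq_maxr _ _) (leq_maxl _ _).
have V2 := V psi2 b L2 m2 bN (leq_maxr _ _) (leq_maxl _ _).
have CS : Z ^+ 2 <= (q ^+ (L1 - k) * (K * q ^+ a * N%:R ^+ c)) * (q ^+ (L2 - k) * (K * q ^+ b * N%:R ^+ c)).
  apply: le_trans (weighted_cauchy_schwarz _ _ _) _; first by move=> p _; rewrite invr_ge0.
  by apply: ler_pM V1 V2; apply: sumr_ge0 => p _; rewrite mulr_ge0 ?invr_ge0 ?sqr_ge0.
rewrite exprMn; apply: le_trans (ler_wpM2r _ CS) _; first by rewrite !exprn_ge0.
have := sieve_exponents (card_finNzRing_gt1 F) DB abN hk ha hb hB N0.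
rewrite -(ler_nat R) natrM !natrX -/(qR R F) -/L1 -/L2 => h.
have -> : q ^+ (L1 - k) * (K * q ^+ a * N%:R ^+ c) * (q ^+ (L2 - k) * (K * q ^+ b * N%:R ^+ c)) * (N%:R ^+ D) ^+ 2
  = (K * N%:R ^+ c) ^+ 2 * (q ^+ ((L1 - k) + (L2 - k) + (a + b)) * N%:R ^+ (2 * D)).
  by rewrite -exprM (mulnC D 2) !exprD; ring.
have -> : (K * N%:R ^+ c * q ^+ N.+1) ^+ 2 = (K * N%:R ^+ c) ^+ 2 * q ^+ (2 * N.+1).
  by rewrite exprMn -exprM [(_ * 2)%N]mulnC.
by rewrite ler_wpM2l // sqr_ge0.
Qed.

(** The weight 1 / phi(d) averages over the characters modulo [d], and there are at most q^k <= N^D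
    moduli [d]. A saving of N^(2D) in each term thus leaves N^D. *)
Lemma degree_sum_small psi1 psi2 (Z : R) (D N B a b k : nat) e : 0 <= Z ->
  (0 < N)%N -> (#|F| ^ k <= N ^ D)%N ->
  (forall d (j : 'I_(phi d)), size d = k.+1 -> inducing R (d * e) j ->
     nc (coprime_twist psi1 a (d * e) (dchar R j)) *
     nc (coprime_twist psi2 b (d * e) (dchar R j)) * N%:R ^+ (2 * D) <= Z) ->
  degree_sum psi1 psi2 a b N B k e * N%:R ^+ D <= Z.
Proof.
move=> Z0 N0 kD h.
have Np n : 0 < N%:R ^+ n :> R by rewrite exprn_gt0 // ltr0n.
rewrite -(ler_pM2r (Np D)) -mulrA -exprD addnn -mul2n.
apply: (@le_trans _ _ (Z * (#|F| ^ k)%:R)); last by rewrite ler_wpM2l // -natrX ler_nat.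
apply: (@le_trans _ _ (\sum_(d : {poly_k.+1 F} | monic_deg k d) Z)); last first.
  by rewrite sumr_const -[_ *+ _]mulr_natr ler_wpM2l // ler_nat card_monic_deg.
rewrite /degree_sum mulr_suml.
apply: (@ler_sum_cover _ _ _ _ _ (fun (d : {poly_N.+1 F}) (d' : {poly_k.+1 F}) => (d : {poly F}) = d')) => //.
- move=> d /andP[/andP[dm _] /eqP ds]; exists (npolyp k.+1 d); rewrite npolypK ?ds //.
  exact/monic_degP.
- by move=> d d' d'' _ _ e1 e2; apply: npoly_inj; rewrite e1 e2.
- move=> d _ /andP[/andP[dm _] /eqP ds] _ _.
  have p0 : 0 < (phi d)%:R :> R by rewrite ltr0n phi_gt0 ?monic_neq0.
  have ZE : (phi d)%:R * Z = \sum_(j < phi d) Z by rewrite sumr_const card_ord -(mulr_natl Z).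
  rewrite -mulrA ler_pdivrMl // ZE mulr_suml big_mkcond; apply: ler_sum => j _; case: ifP => // ind; exact: h.
Qed.

End DegreeSums.

(** * Bilinear bounds *)

(** [N] is at most a constant times q^x with [x = N %/ (6 * s.+1)], and [x * s <= N %/ 6]. The sixth
    of [N] is the room left in [bilinear_small_degrees]. *)
Lemma expn_le_exp (q s : nat) : 1 < q -> exists K, forall N, N ^ s <= K * q ^ (N %/ 6).
Proof.
move=> q1; exists ((6 * s.+1) ^ s) => N; pose x := N %/ (6 * s.+1).
have Nx : N <= 6 * s.+1 * q ^ x.
  apply: (@leq_trans (6 * s.+1 * x.+1)); last by rewrite leq_mul2l /= ltn_expl.
  by rewrite ltnW // mulnC ltn_ceil.
apply: leq_trans (leq_expX s Nx) _; rewrite expnMn leq_mul2l -expnM; apply/orP; right.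
rewrite leq_exp2l // /x divnMA mulnC; apply: leq_trans (leq_trunc_div _ s.+1).
by rewrite mulnC leq_mul2l leqnSn orbT.
Qed.

Section Assembly.
Local Open Scope ring_scope.
Variables (R : realType) (F : finFieldType).
Implicit Types (psi : arithfun R F) (f g h m d e l : {poly F}).
Local Notation nc := (@Normc.normc R).
Local Notation q := (qR R F).

Lemma sum_by_degree (N : nat) (P : pred {poly F}) (u : {poly F} -> R) :
  (forall f, P f -> f \is monic) ->
  \sum_(f : {poly_N.+1 F} | P f) u f =
  \sum_(k < N.+1) \sum_(f : {poly_N.+1 F} | P f && (size f == k.+1)) u f.
Proof.
move=> Pm; rewrite (partition_big (fun f : {poly_N.+1 F} => inord (size f).-1 : 'I_N.+1) xpredT) //=.
apply: eq_bigr => k _; apply: eq_bigl => f.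
have [Pf|//] := boolP (P f); rewrite /=.
have f0 : (0 < size f)%N by rewrite size_poly_gt0 monic_neq0 // Pm.
by rewrite -val_eqE /= inordK ?prednK // -eqSS prednK.
Qed.

Lemma sum_inv_phi_le N :
  \sum_(e : {poly_N.+1 F} | (e : {poly F}) \is monic) (phi e)%:R^-1 <= N.+1%:R ^+ 2 :> R.
Proof.
rewrite (@sum_by_degree N (fun e => e \is monic) (fun e => (phi e)%:R^-1)) //.
apply: (@le_trans _ _ (\sum_(k < N.+1) N.+1%:R)); last first.
  by rewrite sumr_const card_ord -[_ *+ _]mulr_natr expr2.
apply: ler_sum => k _; apply: (@le_trans _ _ k.+1%:R); last by rewrite ler_nat.
apply: le_trans (sum_inv_phi F R k).
rewrite (@sum_npoly_widen _ _ k.+1 N.+1 (monic_deg k) (fun e => (phi e)%:R^-1)) //.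
by move=> f /monic_degP[_ ->].
Qed.

Lemma small_modulus_monic N B m : small_modulus N B m -> m \is monic.
Proof. by case/andP. Qed.

(** In [N.+1 ^+ 3] one factor counts the degrees [k] of the conductor and two come from the sum of 1
    / phi(e). *)
Lemma bilinear_sum_le psi1 psi2 (Z : R) (N B D a b : nat) : (0 < N)%N ->
  (forall k e, (k <= N)%N -> e \is monic -> degree_sum psi1 psi2 a b N B k e * N%:R ^+ D <= Z) ->
  (\sum_(m : {poly_N.+1 F} | small_modulus N B m) bilinear_max psi1 psi2 a b m) * N%:R ^+ D
    <= N.+1%:R ^+ 3 * Z.
Proof.
move=> N0 h; have Np : 0 < N%:R ^+ D :> R by rewrite exprn_gt0 ?ltr0n.
have Z0 : 0 <= Z.
  apply: le_trans (h 0%N 1 _ _) => //; last exact: monic1.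
  by rewrite mulr_ge0 ?degree_sum_ge0 // ltW.
pose U := fun m d (j : 'I_(phi d)) => nc (coprime_twist psi1 a m (dchar R j)) * nc (coprime_twist psi2 b m (dchar R j)).
have U0 m d j : 0 <= @U m d j by rewrite mulr_ge0 ?normc_ge0.
rewrite -ler_pdivlMr //.
apply: (@le_trans _ _ (\sum_(m : {poly_N.+1 F} | small_modulus N B m) (phi m)%:R^-1 *
    \sum_(d : {poly_N.+1 F}) \sum_(j < phi d | inducing R m j) U m d j)).
  apply: ler_sum => m /small_modulus_monic mm; have m0 := monic_neq0 mm.
  have Y0 : 0 <= (phi m)%:R^-1 * \sum_(d : {poly_N.+1 F}) \sum_(j < phi d | inducing R m j) U m d j.
    by rewrite mulr_ge0 ?invr_ge0 ?ler0n // sumr_ge0 // => d _; apply: sumr_ge0.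
  apply: bilinear_max_le => // l lm; apply: le_trans (bilinear_discrepancy_le _ _ _ _ m0 lm) _.
  by rewrite ler_wpM2l ?invr_ge0 ?ler0n // nonprincipal_sum_le // size_npoly.
apply: le_trans (modulus_sum_le B N0 U0) _.
have inner e : e \is monic -> \sum_(d : {poly_N.+1 F} | small_modulus N B d) (phi d)%:R^-1 *
      \sum_(j < phi d | inducing R ((d : {poly F}) * e) j) U ((d : {poly F}) * e) d j <= N.+1%:R * (Z / N%:R ^+ D).
  move=> em; rewrite (@sum_by_degree N (small_modulus N B) (fun d => (phi d)%:R^-1 *
      \sum_(j < phi d | inducing R (d * e) j) U (d * e) d j)); last exact: small_modulus_monic.
  apply: (@le_trans _ _ (\sum_(k < N.+1) Z / N%:R ^+ D)).
    by apply: ler_sum => k _; rewrite ler_pdivlMr //; apply: h => //; rewrite -ltnS.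
  by rewrite sumr_const card_ord -[_ *+ _]mulr_natl.
apply: (@le_trans _ _ (\sum_(e : {poly_N.+1 F} | (e : {poly F}) \is monic) (phi e)%:R^-1 * (N.+1%:R * (Z / N%:R ^+ D)))).
  by apply: ler_sum => e em; rewrite ler_wpM2l ?invr_ge0 ?ler0n // inner.
rewrite -mulr_suml; apply: le_trans (ler_wpM2r _ (sum_inv_phi_le N)) _.
  by rewrite !mulr_ge0 ?invr_ge0 ?ler0n // ltW.
by rewrite -[leRHS]mulrA (exprSr _ 2) -[leRHS]mulrA.
Qed.

(** The twist is the sum against the imprimitive character modulo [m] itself. The Siegel-Walfisz
    constant does not depend on the modulus, so the coprimality condition to the cofactor costs
    nothing. *)
Lemma inducing_siegel_walfisz psi (K : R) (D a : nat) m d (j : 'I_(phi d)) :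
  siegel_walfisz_bound psi D K ->
  m != 0 -> (0 < a)%N -> inducing R m j -> (#|F| ^ (size d).-1 <= a ^ D)%N ->
  nc (coprime_twist psi a m (dchar R j)) * a%:R ^+ (3 * D) <= K * q ^+ a.
Proof.
move=> h m0 a0 /asboolP[i ind] qd; have [XD _ _ _] := dcharP R m0.
rewrite -(induces_twist _ _ m0 ind); case: ind => /asboolP np cd sd _ _.
have sm : (1 < size m)%N by case: cd => _ dm _ _; apply: leq_trans sd (dvdp_leq m0 dm).
by apply: (h a m d (dchar R i) a0 sm _ np cd qd); apply/(character_modP _ m0)/XD.
Qed.

Lemma coprime_twist_le psi a m d (j : 'I_(phi d)) : d != 0 ->
  nc (coprime_twist psi a m (dchar R j)) <= \sum_(f : {poly_a.+1 F} | monic_deg a f) nc (psi f).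
Proof.
move=> d0; have [XD _ _ _] := dcharP R d0; apply: twisted_sum_le => f.
have n1 := dirichlet_norm_le1 d0 (XD j).
by case: (coprimep f m); rewrite ?mul1r ?mul0r ?Normc.normc0.
Qed.

Lemma bilinear_trivial_le psi1 psi2 a b m : m != 0 ->
  bilinear_max psi1 psi2 a b m <=
  2 * ((\sum_(f : {poly_a.+1 F} | monic_deg a f) nc (psi1 f)) *
       (\sum_(f : {poly_b.+1 F} | monic_deg b f) nc (psi2 f))).
Proof.
move=> m0; set S := (X in 2 * X).
have S0 : 0 <= S by apply: mulr_ge0; apply: sumr_ge0 => f _; apply: normc_ge0.
apply: bilinear_max_le => //; first by rewrite mulr_ge0.
move=> l _; rewrite /bilinear_discrepancy.
have B (Q : {poly F} -> {poly F} -> bool) :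
    nc (\sum_(g : {poly_a.+1 F} | monic_deg a g) \sum_(h : {poly_b.+1 F} | monic_deg b h)
      psi1 g * psi2 h * (Q g h)%:R) <= S.
  apply: le_trans (normc_sum _ _ _) _; rewrite /S mulr_suml; apply: ler_sum => g _.
  apply: le_trans (normc_sum _ _ _) _; rewrite mulr_sumr; apply: ler_sum => h _.
  case: (Q _ _); first by rewrite mulr1 Normc.normcM.
  by rewrite mulr0 Normc.normc0 mulr_ge0 ?normc_ge0.
apply: le_trans (le_normcD _ _) _; rewrite normcN mulr_natl mulr2n; apply: lerD.
  exact: (B (fun g h => (g * h) %% m == l %% m)).
rewrite Normc.normcM Normc.normcV normc_nat -[leRHS]mul1r; apply: ler_pM; rewrite ?invr_ge0 ?ler0n ?normc_ge0 //.
  by rewrite invf_le1 ?ltr0n ?ler1n phi_gt0.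
exact: (B (fun g h => coprimep (g * h) m)).
Qed.

Lemma card_small_modulus N B : (0 < N)%N ->
  (#|[pred m : {poly_N.+1 F} | small_modulus N B m]| <= #|F| ^ (N./2).+1)%N.
Proof.
move=> N0; rewrite -card_npoly.
have sz m : small_modulus N B m -> (size m <= (N./2).+1)%N.
  move=> /andP[mm mB]; have : (#|F| ^ (2 * (size m).-1) <= #|F| ^ N)%N.
    by apply: leq_trans mB; rewrite leq_pmulr // expn_gt0 N0.
  rewrite leq_exp2l ?card_finNzRing_gt1 //; have := monic_neq0 mm; rewrite -size_poly_gt0.
  by move: (size m) => s; clear; lia.
pose h (m : {poly_N.+1 F}) : {poly_(N./2).+1 F} := npolyp _ m.
have hI : {in [pred m : {poly_N.+1 F} | small_modulus N B m] &, injective h}.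
  move=> m m'; rewrite !inE => sm sm' /(congr1 (@polyn _ _)).
  by rewrite !npolypK ?sz // => /npoly_inj.
by rewrite -(card_in_imset hI) max_card.
Qed.

Lemma small_modulus_le N B B' m : (0 < N)%N -> (B <= B')%N ->
  small_modulus N B' m -> small_modulus N B m.
Proof.
move=> N0 BB /andP[mm mB]; rewrite /small_modulus mm /=; apply: leq_trans mB.
by rewrite leq_mul2l leq_pexp2l ?orbT // leq_mul2l BB.
Qed.

Lemma bilinear_maxC psi1 psi2 a b m : bilinear_max psi1 psi2 a b m = bilinear_max psi2 psi1 b a m.
Proof. by apply: eq_bigr => l _; rewrite bilinear_discrepancyC. Qed.

(** In the exponent [E + c + A], [E] pays for the q^a values of the short variable, [c] for the
    moment of [psi1], and [A] is the saving kept. *)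
Lemma bilinear_short_le psi1 psi2 (K K' : R) (c A E B B' N a b : nat) :
  0 <= K -> moment_bound psi1 K c -> (0 < N)%N -> (a <= N)%N -> (b <= N)%N -> (B' <= B)%N ->
  (\sum_(m : {poly_N.+1 F} | small_modulus N B' m) bvE_max N m psi2) * N%:R ^+ (E + c + A)
    <= K' * q ^+ N ->
  (#|F| ^ a <= N ^ E)%N ->
  (\sum_(m : {poly_N.+1 F} | small_modulus N B m) bilinear_max psi1 psi2 a b m) * N%:R ^+ A
    <= K * K' * q ^+ N.
Proof.
move=> K0 mb N0 aN bN BB hB aE.
have [mb1 _] := mb N a N0 aN.
set S := \sum_(m | _) bvE_max _ _ _ in hB.
have S0 : 0 <= S by apply: sumr_ge0 => m _; apply: bvE_max_ge0.
have T : \sum_(m : {poly_N.+1 F} | small_modulus N B m) bilinear_max psi1 psi2 a b m <=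
    K * N%:R ^+ E * N%:R ^+ c * S.
  rewrite /S mulr_sumr [leLHS]big_mkcond [leRHS]big_mkcond; apply: ler_sum => m _.
  have Y0 : 0 <= K * N%:R ^+ E * N%:R ^+ c by rewrite !mulr_ge0 ?exprn_ge0.
  case: ifP => [sm|_]; last by case: ifP => // _; rewrite mulr_ge0 ?bvE_max_ge0.
  rewrite (small_modulus_le N0 BB sm).
  have m0 := monic_neq0 (small_modulus_monic sm).
  apply: bilinear_max_le => //; first by rewrite mulr_ge0 ?bvE_max_ge0.
  move=> l lm; apply: le_trans (bilinear_discrepancy_le_bvE _ _ _ m0 bN lm) _.
  rewrite ler_wpM2r ?bvE_max_ge0 //; apply: le_trans mb1 _.
  rewrite ler_wpM2r ?exprn_ge0 // ler_wpM2l //.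
  by rewrite /qR -!natrX ler_nat.
apply: le_trans (ler_wpM2r _ T) _; first by rewrite exprn_ge0.
have -> : K * N%:R ^+ E * N%:R ^+ c * S * N%:R ^+ A = K * (S * N%:R ^+ (E + c + A)).
  by rewrite !exprD; ring.
by rewrite -mulrA ler_wpM2l.
Qed.

End Assembly.

(** * Convolutions *)

(** From (a - 3)^2 >= 0 one has 6 a <= a^2 + 9. *)
Lemma mul6_le_sqr a N : a * a < N -> 6 * a <= N + 8.
Proof. by case: a => [|[|[|a]]]; [lia | lia | lia | nia]. Qed.

Section BombieriVinogradov.
Local Open Scope ring_scope.
Variables (R : realType) (F : finFieldType).
Implicit Types (psi : arithfun R F) (f g h m d e l : {poly F}).
Local Notation nc := (@Normc.normc R).
Local Notation q := (qR R F).

Lemma expr_le_q (s : nat) : exists2 K : R, 0 <= K & forall N, N%:R ^+ s <= K * q ^+ (N %/ 6).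
Proof.
have [K hK] := expn_le_exp s (card_finNzRing_gt1 F).
by exists K%:R => // N; rewrite /qR -!natrX -natrM ler_nat.
Qed.

(** The trivial bound: the moduli number about q^(N/2), [mul6_le_sqr] gives q^(a + b) at most about
    q^(N/3), and the remaining q^(N/6) absorbs the powers of [N]. *)
Lemma bilinear_small_degrees psi1 psi2 (K K' : R) (c A B N a b : nat) :
  0 <= K -> 0 <= K' -> moment_bound psi1 K c -> moment_bound psi2 K c ->
  (forall N, N%:R ^+ (2 * c + A) <= K' * q ^+ (N %/ 6)) ->
  (0 < N)%N -> (a + b <= N)%N -> (a * a < N)%N -> (b * b < N)%N ->
  (\sum_(m : {poly_N.+1 F} | small_modulus N B m) bilinear_max psi1 psi2 a b m) * N%:R ^+ A
    <= 2 * K ^+ 2 * K' * q ^+ 3 * q ^+ N.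
Proof.
move=> K0 K'0 m1 m2 hX N0 abN aa bb.
have aN : (a <= N)%N := leq_trans (leq_addr _ _) abN.
have bN : (b <= N)%N := leq_trans (leq_addl _ _) abN.
have exps : ((N./2).+1 + (a + b) + N %/ 6 <= N + 3)%N.
  by move: (mul6_le_sqr aa) (mul6_le_sqr bb); clear; lia.
have [m1a _] := m1 N a N0 aN; have [m2b _] := m2 N b N0 bN.
set X := K * q ^+ a * N%:R ^+ c in m1a; set Y := K * q ^+ b * N%:R ^+ c in m2b.
have X0 : 0 <= X by rewrite !mulr_ge0 ?exprn_ge0 ?qX_ge0.
have Y0 : 0 <= Y by rewrite !mulr_ge0 ?exprn_ge0 ?qX_ge0.
have T : \sum_(m : {poly_N.+1 F} | small_modulus N B m) bilinear_max psi1 psi2 a b m <=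
    q ^+ (N./2).+1 * (2 * (X * Y)).
  apply: (@le_trans _ _ (\sum_(m : {poly_N.+1 F} | small_modulus N B m) 2 * (X * Y))).
    apply: ler_sum => m /small_modulus_monic mm.
    apply: le_trans (bilinear_trivial_le _ _ _ _ (monic_neq0 mm)) _.
    rewrite ler_wpM2l //; apply: ler_pM => //; apply: sumr_ge0 => f _; exact: normc_ge0.
  rewrite sumr_const -(mulr_natl (2 * (X * Y))) ler_wpM2r //.
    by do 2![apply: mulr_ge0 => //].
  by rewrite /qR -natrX ler_nat card_small_modulus.
apply: le_trans (ler_wpM2r _ T) _; first by rewrite exprn_ge0.
have -> : q ^+ (N./2).+1 * (2 * (X * Y)) * N%:R ^+ A =
    2 * K ^+ 2 * (q ^+ ((N./2).+1 + (a + b)) * N%:R ^+ (2 * c + A)).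
  by rewrite /X /Y mul2n -addnn !exprD; ring.
have -> : 2 * K ^+ 2 * K' * q ^+ 3 * q ^+ N = 2 * K ^+ 2 * (K' * q ^+ (N + 3)).
  by rewrite exprD; ring.
rewrite ler_wpM2l ?mulr_ge0 ?sqr_ge0 //.
apply: le_trans (ler_wpM2l (qX_ge0 R F _) (hX N)) _.
by rewrite mulrCA ler_wpM2l // -exprD ler_qX.
Qed.

Lemma bilinear_long psi1 psi2 (K K1 : R) (c D B N a b : nat) :
  0 <= K -> 0 <= K1 -> moment_bound psi1 K c -> moment_bound psi2 K c ->
  siegel_walfisz_bound psi1 (2 * D) K1 ->
  (0 < N)%N -> (a + b <= N)%N -> (N <= a * a)%N -> (D <= B)%N ->
  (N ^ (2 * D) <= #|F| ^ a)%N -> (N ^ (2 * D) <= #|F| ^ b)%N ->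
  (\sum_(m : {poly_N.+1 F} | small_modulus N B m) bilinear_max psi1 psi2 a b m) * N%:R ^+ D
    <= N.+1%:R ^+ 3 * ((K * q + K1 * K) * (N%:R ^+ c * q ^+ N)).
Proof.
move=> K0 K10 m1 m2 sw N0 abN aa DB ha hb.
have bN : (b <= N)%N := leq_trans (leq_addl _ _) abN.
have NQ0 : 0 <= N%:R ^+ c * q ^+ N by rewrite mulr_ge0 ?exprn_ge0 ?qX_ge0.
have q0 : 0 <= q := ltW (q_gt0 R F).
have a0 : (0 < a)%N by rewrite lt0n; apply: contraTneq aa => ->; rewrite -ltnNge.
apply: bilinear_sum_le => // k e kN em.
have [kD|kD] := leqP (#|F| ^ k) (N ^ D); last first.
  apply: le_trans (degree_sum_large e K0 m1 m2 N0 DB abN (ltnW kD) ha hb) _.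
  rewrite exprS mulrDl; apply: (@le_trans _ _ (K * q * (N%:R ^+ c * q ^+ N))).
    by rewrite le_eqVlt; apply/orP; left; apply/eqP; ring.
  by rewrite lerDl mulr_ge0 // mulr_ge0.
apply: (degree_sum_small B _ N0 kD) => [|d j ds ind]; first by rewrite mulr_ge0 // addr_ge0 ?mulr_ge0.
have [dm _ _ _] := inducing_dvd ind.
have d0 := monic_neq0 dm; have de0 : d * e != 0 by rewrite mulf_neq0 // monic_neq0.
(* The Siegel-Walfisz exponent is [2 * D] because [N <= a * a] turns [N ^ D] into at most
   [a ^ (2 * D)]. *)
have qd : (#|F| ^ (size d).-1 <= a ^ (2 * D))%N.
  rewrite ds expnM; apply: leq_trans kD _; apply: leq_expX.
  by rewrite expnS expn1.
have T1 := inducing_siegel_walfisz sw de0 a0 ind qd.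
have [m2b _] := m2 N b N0 bN.
have T2 := le_trans (coprime_twist_le psi2 b (d * e) j d0) m2b.
set X := nc _ in T1 *; set Y := nc _ in T2 *.
have X0 : 0 <= X := normc_ge0 _; have Y0 : 0 <= Y := normc_ge0 _.
have NA : N%:R ^+ (2 * D) <= a%:R ^+ (3 * (2 * D)) :> R.
  rewrite -!natrX ler_nat [X in (_ <= _ ^ X)%N]mulnCA [X in (_ <= X)%N]expnM.
  apply: (@leq_trans (N ^ (3 * D))).
    by rewrite leq_pexp2l // leq_mul2r orbT.
  by apply: leq_expX; rewrite expnS expn1.
have XN : X * N%:R ^+ (2 * D) <= K1 * q ^+ a by apply: le_trans T1; rewrite ler_wpM2l.
apply: (@le_trans _ _ ((K1 * q ^+ a) * (K * q ^+ b * N%:R ^+ c))).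
  by rewrite mulrAC; apply: ler_pM => //; rewrite mulr_ge0 ?exprn_ge0.
have -> : K1 * q ^+ a * (K * q ^+ b * N%:R ^+ c) = K1 * K * (N%:R ^+ c * q ^+ (a + b)).
  by rewrite exprD; ring.
rewrite mulrDl; apply: (@le_trans _ _ (K1 * K * (N%:R ^+ c * q ^+ N))); last by rewrite lerDr mulr_ge0 // mulr_ge0.
by rewrite ler_wpM2l ?mulr_ge0 // ler_wpM2l ?exprn_ge0 // ler_qX.
Qed.

Lemma bilinear_bound psi1 psi2 : nat_growth psi1 -> nat_growth psi2 ->
  nat_siegel_walfisz psi1 -> nat_siegel_walfisz psi2 ->
  nat_bombieri_vinogradov psi1 -> nat_bombieri_vinogradov psi2 ->
  forall A : nat, exists (B : nat) (K : R), 0 <= K /\ forall N a b, (0 < N)%N -> (a + b <= N)%N ->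
    (\sum_(m : {poly_N.+1 F} | small_modulus N B m) bilinear_max psi1 psi2 a b m) * N%:R ^+ A
      <= K * q ^+ N.
Proof.
move=> g1 g2 [D1 sw1] [D2 sw2] bv1 bv2 A.
have [Ka [ca [Ka0 ma]]] := nat_growth_moments g1.
have [Kb [cb [Kb0 mb]]] := nat_growth_moments g2.
pose c := (ca + cb)%N; pose K := Ka + Kb.
have K0 : 0 <= K by rewrite addr_ge0.
have m1 : moment_bound psi1 K c by apply: moment_bound_le ma; rewrite ?lerDl ?leq_addr.
have m2 : moment_bound psi2 K c by apply: moment_bound_le mb; rewrite ?lerDr ?leq_addl.
(* [c + 3] pays for the moment factor and for the cube in [bilinear_sum_le]; [D1 + D2] puts [2 * D]
   beyond both Siegel-Walfisz thresholds. *)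
pose D := (A + c + 3 + D1 + D2)%N.
have [|K1 [K10 {}sw1]] := sw1 (2 * D)%N; first by rewrite /D; clear; lia.
have [|K2 [K20 {}sw2]] := sw2 (2 * D)%N; first by rewrite /D; clear; lia.
have [B1 [K3 [K30 {}bv1]]] := bv1 (2 * D + c + A)%N.
have [B2 [K4 [K40 {}bv2]]] := bv2 (2 * D + c + A)%N.
have [K5 K50 hX] := expr_le_q (2 * c + A).
(* Enlarging [B] only removes moduli, so one [B] serves both Bombieri-Vinogradov hypotheses and the
   condition [D <= B] of the sieve. *)
pose B := (D + B1 + B2)%N.
pose Kl := 8 * ((K * q + K1 * K) + (K * q + K2 * K)).
have q0 : 0 <= q := ltW (q_gt0 R F).
have Kl1 : 0 <= K * q + K1 * K by rewrite addr_ge0 ?mulr_ge0.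
have Kl2 : 0 <= K * q + K2 * K by rewrite addr_ge0 ?mulr_ge0.
pose Ks := 2 * K ^+ 2 * K5 * q ^+ 3.
have Ks0 : 0 <= Ks by rewrite !mulr_ge0 ?sqr_ge0 ?qX_ge0.
exists B, (Ks + K * K4 + K * K3 + Kl).
split; first by rewrite !addr_ge0 // mulr_ge0 // addr_ge0.
move=> N a b N0 abN.
have aN : (a <= N)%N := leq_trans (leq_addr _ _) abN.
have bN : (b <= N)%N := leq_trans (leq_addl _ _) abN.
have Np n : 0 < N%:R ^+ n :> R by rewrite exprn_gt0 // ltr0n.
have KK3 : 0 <= K * K3 by rewrite mulr_ge0.
have KK4 : 0 <= K * K4 by rewrite mulr_ge0.
have Kl0 : 0 <= Kl by rewrite mulr_ge0 // addr_ge0.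
have wK (x : R) (S : R) : S <= x * q ^+ N -> x <= Ks + K * K4 + K * K3 + Kl ->
    S <= (Ks + K * K4 + K * K3 + Kl) * q ^+ N.
  by move=> Sx xK; apply: le_trans Sx _; rewrite ler_wpM2r ?qX_ge0.
have [le1 le2 le3 le4] : [/\ Ks <= Ks + K * K4 + K * K3 + Kl, K * K4 <= Ks + K * K4 + K * K3 + Kl,
    K * K3 <= Ks + K * K4 + K * K3 + Kl & Kl <= Ks + K * K4 + K * K3 + Kl].
  by move: Ks0 KK3 KK4 Kl0; clear; split; lra.
have long (x S : R) : 0 <= x -> S * N%:R ^+ D <= N.+1%:R ^+ 3 * (x * (N%:R ^+ c * q ^+ N)) -> 
    S * N%:R ^+ A <= 8 * x * q ^+ N.
  move=> x0 hS; have AD : (A + (c + 3) <= D)%N by rewrite /D; clear; lia.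
  have [S0|S0] := leP 0 S; last first.
    by apply: (@le_trans _ _ 0); [rewrite pmulr_lle0 // ltW | rewrite !mulr_ge0 ?qX_ge0].
  rewrite -(ler_pM2r (Np (c + 3)%N)) -[leLHS]mulrA -exprD.
  apply: (@le_trans _ _ (S * N%:R ^+ D)).
    by rewrite ler_wpM2l // ler_weXn2l // ler1n.
  apply: le_trans hS _.
  have N3 : N.+1%:R ^+ 3 <= 8 * N%:R ^+ 3 :> R.
    have -> : 8 * N%:R ^+ 3 = (2 * N%:R) ^+ 3 :> R by rewrite exprMn; congr (_ * _); ring.
    by apply: lerXn2r; rewrite ?nnegrE ?mulr_ge0 // -natrM ler_nat mul2n -addnn -addn1 leq_add2l.
  apply: le_trans (ler_wpM2r _ N3) _; first by rewrite !mulr_ge0 ?qX_ge0 // ltW.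
  by rewrite le_eqVlt; apply/orP; left; apply/eqP; rewrite exprD; ring.
have [ha|ha] := leqP (N ^ (2 * D)) (#|F| ^ a); last first.
  apply: (wK (K * K4)).
    by apply: (@bilinear_short_le _ _ psi1 psi2 K K4 c A (2 * D) B B2) => //;
      [rewrite /B leq_addl | apply: bv2 | apply: ltnW].
  exact: le2.
have [hb|hb] := leqP (N ^ (2 * D)) (#|F| ^ b); last first.
  apply: (wK (K * K3)); last exact: le3.
  under eq_bigr do rewrite bilinear_maxC.
  by apply: (@bilinear_short_le _ _ psi2 psi1 K K3 c A (2 * D) B B1) => //;
      [rewrite /B addnAC leq_addl | apply: bv1 | apply: ltnW].
have DB : (D <= B)%N by rewrite /B -addnA leq_addr.
have [aa|aa] := leqP N (a * a).
  apply: (wK (8 * (K * q + K1 * K))); first last.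
    by apply: le_trans le4; rewrite ler_wpM2l // lerDl.
  by apply: long => //; apply: bilinear_long.
have [bb|bb] := leqP N (b * b).
  apply: (wK (8 * (K * q + K2 * K))); first last.
    by apply: le_trans le4; rewrite ler_wpM2l // lerDr.
  apply: long => //; under eq_bigr do rewrite bilinear_maxC.
  by apply: bilinear_long => //; rewrite addnC.
apply: (wK Ks); last exact: le1.
exact: (bilinear_small_degrees B K0 K50 m1 m2 hX N0 abN aa bb).
Qed.

Lemma nat_bombieri_vinogradov_dconv psi1 psi2 : nat_growth psi1 -> nat_growth psi2 ->
  nat_siegel_walfisz psi1 -> nat_siegel_walfisz psi2 ->
  nat_bombieri_vinogradov psi1 -> nat_bombieri_vinogradov psi2 ->
  nat_bombieri_vinogradov (dconv psi1 psi2).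
Proof.
move=> g1 g2 sw1 sw2 bv1 bv2 A.
(* The extra 2 pays for the at most [N.+1 ^ 2 <= 4 * N ^ 2] pairs of degrees [M] and [a]. *)
have [B [K [K0 h]]] := bilinear_bound g1 g2 sw1 sw2 bv1 bv2 (A + 2)%N.
exists B, (4 * K); split=> [|N N0]; first by rewrite mulr_ge0.
have Np n : 0 < N%:R ^+ n :> R by rewrite exprn_gt0 // ltr0n.
rewrite -(ler_pM2r (Np 2)) -[leLHS]mulrA -exprD.
apply: (@le_trans _ _ (\sum_(M < N.+1) \sum_(a < N.+1) K * q ^+ N)); last first.
  rewrite !sumr_const card_ord -mulrnA -(mulr_natl (K * q ^+ N)).
  have -> : 4 * K * q ^+ N * N%:R ^+ 2 = (4 * N%:R ^+ 2) * (K * q ^+ N) by ring.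
  rewrite ler_wpM2r ?mulr_ge0 ?qX_ge0 // -natrX -natrM ler_nat.
  by clear -N0; rewrite expnS expn1; nia.
apply: (@le_trans _ _ (\sum_(M < N.+1) \sum_(a < M.+1)
   (\sum_(m : {poly_N.+1 F} | small_modulus N B m) bilinear_max psi1 psi2 a (M - a) m) * N%:R ^+ (A + 2))).
  under [leRHS]eq_bigr do rewrite -mulr_suml.
  rewrite -mulr_suml ler_wpM2r ?exprn_ge0 //.
  under [leRHS]eq_bigr do rewrite exchange_big.
  rewrite exchange_big; apply: ler_sum => m _; exact: bvE_max_dconv.
apply: ler_sum => M _; have MN : (M <= N)%N by rewrite -ltnS.
apply: (@le_trans _ _ (\sum_(a < M.+1) K * q ^+ N)).
  apply: ler_sum => a _; apply: h => //.
  by rewrite subnKC // -ltnS.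
have Z0 : 0 <= K * q ^+ N by rewrite mulr_ge0 ?qX_ge0.
rewrite !sumr_const !card_ord -(mulr_natl (K * q ^+ N) M.+1) -(mulr_natl (K * q ^+ N) N.+1).
by rewrite ler_wpM2r // ler_nat ltnS.
Qed.

End BombieriVinogradov.

(** * Iterated convolutions *)

Section Iterated.
Local Open Scope ring_scope.
Variables (R : realType) (F : finFieldType).

(** The three properties are carried through the induction together: equidistribution of a
    convolution uses growth and Siegel-Walfisz for both factors. *)
Definition equidistributed (psi : arithfun R F) :=
  [/\ nat_growth psi, nat_siegel_walfisz psi & nat_bombieri_vinogradov psi].

Lemma equidistributed_dconv (psi1 psi2 : arithfun R F) :
  equidistributed psi1 -> equidistributed psi2 -> equidistributed (dconv psi1 psi2).
Proof.
move=> [g1 s1 b1] [g2 s2 b2]; split.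
- exact: nat_growth_dconv.
- exact: nat_siegel_walfisz_dconv.
- exact: nat_bombieri_vinogradov_dconv.
Qed.

Lemma equidistributed_dconvs (n : nat) (psi : 'I_n.+1 -> arithfun R F) :
  (forall i, equidistributed (psi i)) -> equidistributed (dconvs psi).
Proof.
(* The head is generalized because it is the accumulator of the left fold. *)
move=> h; rewrite /dconvs; move: (psi ord0) (h ord0).
elim: (enum 'I_n) => [//|i s IH] psi0 h0 /=.
exact/IH/equidistributed_dconv.
Qed.

End Iterated.

Theorem corollary1p2 (R : realType) (F : finFieldType) (n : nat)
    (psi : 'I_n.+1 -> arithfun R F)
    (hgrowth : forall i, growth_condition (psi i))
    (hSW : forall i, siegel_walfisz (psi i))
    (hBV : forall i, bombieri_vinogradov (psi i)) :
  [/\ growth_condition (dconvs psi),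
      siegel_walfisz (dconvs psi) &
      bombieri_vinogradov (dconvs psi)].
Proof.
have [i|g s b] := @equidistributed_dconvs R F n psi.
  by split; [apply/growthP | apply/siegel_walfiszP | apply/bombieri_vinogradovP].
by split; [apply/growthP | apply/siegel_walfiszP | apply/bombieri_vinogradovP].
Qed.
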